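(* (1) If $X$ is a local compactum, then $\tau_0^X\colon pH_0(X)\to qH_0(X)$ is surjective. (2) For every metrizable space $X$, $\tau^0_X\colon pH^0(X)\to qH^0(X)$ is an isomorphism.
   Context: All spaces are metrizable; all (co)homology has integer coefficients. A local compactum is a locally compact separable metrizable space. ANR means absolute neighborhood retract for metrizable spaces. An ANR expansion of $X$ is an inverse system $(P_\lambda,[p^\lambda_\mu];\Lambda)$ of ANRs in the homotopy category, indexed by a directed set, together with maps $p^\infty_\lambda\colon X\to P_\lambda$ commuting up to homotopy with the bonding maps, such that for every ANR $K$: (E1) every map $f\colon X\to K$ is homotopic to $f'_\lambda p^\infty_\lambda$ for some $\lambda$ and some map $f'_\lambda\colon P_\lambda\to K$; (E2) if $f,g\colon P_\kappa\to K$ are such that $fp^\infty_\kappa$ and $gp^\infty_\kappa$ are homotopic, then $fp^\lambda_\kappa$ and $gp^\lambda_\kappa$ are homotopic for some $\lambda\ge\kappa$. (For example, the nerves of all open covers of $X$ form an ANR expansion.) Any two ANR expansions of $X$ are isomorphic in pro-homotopy. $H^n$ is Čech cohomology. For an ANR $P$, $H_n(P)$ is the usual (singular) homology. Quasi-homology: $qH_n(X)=\lim_\alpha H_n(P_\alpha)$, where the $P_\alpha$ form an ANR expansion of $X$. Quasi-cohomology: $qH^n(X)=\lim_K H^n(K)$ over all compact $K\subset X$. Pseudo-homology: $pH_n(X)=\operatorname{colim}_K qH_n(K)$ over all compact $K\subset X$. Pseudo-cohomology: $pH^n(X)=\operatorname{colim}_\alpha qH^n(P_\alpha)$, where the $P_\alpha$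 form an ANR expansion of $X$. The map $\tau_n^X\colon pH_n(X)\to qH_n(X)$ is the unique homomorphism through which the inclusion-induced maps $qH_n(K)\to qH_n(X)$, $K\subset X$ compact, factor. The map $\tau^n_X\colon pH^n(X)\to qH^n(X)$ is the unique homomorphism through which the homomorphisms $qH^n(P_\alpha)\to qH^n(X)$ induced by the maps $p^\infty_\alpha\colon X\to P_\alpha$ factor. *)

(* Defs.v *)
From HB Require Import structures.
From mathcomp Require Import all_boot all_order all_algebra.
From mathcomp Require Import generic_quotient ring_quotient.
From mathcomp Require Import all_classical all_reals all_analysis.
From mathcomp.multinomials Require Import freeg.

Set Implicit Arguments.
Unset Strict Implicit.
Unset Printing Implicit Defensive.

Import Order.TTheory GRing.Theory Num.Theory.
Import numFieldTopology.Exports.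

Local Open Scope classical_set_scope.
Local Open Scope ring_scope.
Local Open Scope quotient_scope.

Section Span.
Context (G : zmodType) (S : set G).

Definition span : {pred G} :=
  fun x => `[< forall H : {pred G}, zmod_closed H -> S `<=` [set` H] -> x \in H >].

Lemma span_zmod_closed : zmod_closed span.
Proof.
split=> [|x y /asboolP xS /asboolP yS]; apply/asboolP => H Hz SH.
  exact: Hz.1.
exact: Hz.2 (xS _ Hz SH) (yS _ Hz SH).
Qed.

HB.instance Definition _ := GRing.isZmodClosed.Build G span span_zmod_closed.

Lemma sub_span x : S x -> x \in span.
Proof. by move=> Sx; apply/asboolP => H _; apply. Qed.

Definition zquot := Quotient.quot span.
HB.instance Definition _ := GRing.Zmodule.on zquot.

Definition zquot_pi (x : G) : zquot := \pi_(Quotient.quot span) x.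

Lemma zquot_pi_is_additive : zmod_morphism zquot_pi.
Proof. by move=> x y; rewrite /zquot_pi piE. Qed.

HB.instance Definition _ :=
  GRing.isZmodMorphism.Build G zquot zquot_pi zquot_pi_is_additive.

Lemma zquot_pi_eq x y : (zquot_pi x == zquot_pi y) = (x - y \in span).
Proof. by rewrite Quotient.idealrBE. Qed.

End Span.

Section QuotientLift.
Context (G H : zmodType) (S : set G) (f : {additive G -> H}).
Hypothesis fS : forall x, S x -> f x = 0.

Lemma span_eq0 x : x \in span S -> f x = 0.
Proof.
move=> /asboolP /(_ (fun x => f x == 0)) xS; apply/eqP/xS.
  split=> [|u v]; rewrite !unfold_in ?raddf0 // raddfB => /eqP-> /eqP->.
  by rewrite subr0.
by move=> u Su; apply/eqP/fS.
Qed.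

(* The hypothesis fS is an argument so that the instance below applies. *)
Definition zquot_lift of (forall x, S x -> f x = 0) := fun x : zquot S => f (repr x).
Local Notation lift := (zquot_lift fS).

Lemma zquot_liftE x : lift (zquot_pi S x) = f x.
Proof.
apply/eqP; rewrite -subr_eq0 -raddfB; apply/eqP/span_eq0.
by rewrite -zquot_pi_eq /zquot_pi reprK.
Qed.

Lemma zquot_lift_is_additive : zmod_morphism lift.
Proof.
move=> x y; rewrite -[x]reprK -[y]reprK.
rewrite -[\pi_ _ (repr x)]/(zquot_pi S _) -[\pi_ _ (repr y)]/(zquot_pi S _).
by rewrite -raddfB !zquot_liftE raddfB.
Qed.

HB.instance Definition _ :=
  GRing.isZmodMorphism.Build (zquot S) H lift zquot_lift_is_additive.

End QuotientLift.

Section Homology.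
Context (A B C : zmodType) (d : {additive A -> B}) (d' : {additive B -> C}).

Definition zker : {pred B} := fun x => d' x == 0.

Lemma zker_zmod_closed : zmod_closed zker.
Proof.
split=> [|x y]; rewrite !unfold_in ?raddf0 // raddfB => /eqP-> /eqP->.
by rewrite subr0.
Qed.

HB.instance Definition _ := GRing.isZmodClosed.Build B zker zker_zmod_closed.

Definition zcycle := {x : B | x \in zker}.
HB.instance Definition _ := [isSub of zcycle for @sval _ _].
HB.instance Definition _ := [Choice of zcycle by <:].
HB.instance Definition _ := [SubChoice_isSubZmodule of zcycle by <:].

Definition homology := zquot [set z : zcycle | range d (val z)].
HB.instance Definition _ := GRing.Zmodule.on homology.

End Homology.

Section HomologyMap.
Context (A B C A' B' C' : zmodType).
Context (d : {additive A -> B}) (d' : {additive B -> C}).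
Context (e : {additive A' -> B'}) (e' : {additive B' -> C'}).
Context (b : {additive B -> B'}).
Hypothesis b_ker : forall x, d' x = 0 -> e' (b x) = 0.
Hypothesis b_im : forall x, range d x -> range e (b x).

Lemma zcycle_map_subproof (z : zcycle d') : b (val z) \in zker e'.
Proof. by apply/eqP/b_ker/eqP; case: z. Qed.

Definition zcycle_map (z : zcycle d') : zcycle e' :=
  exist _ (b (val z)) (zcycle_map_subproof z).

Lemma zcycle_map_is_additive : zmod_morphism zcycle_map.
Proof. by move=> x y; apply/val_inj; rewrite /= raddfB. Qed.

HB.instance Definition _ :=
  GRing.isZmodMorphism.Build _ _ zcycle_map zcycle_map_is_additive.

Let cls : {additive zcycle d' -> homology e e'} := zquot_pi _ \o zcycle_map.

Lemma homology_map_subproof z : range d (val z) -> cls z = 0.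
Proof.
move=> dz; rewrite -[RHS](raddf0 (zquot_pi _)); apply/eqP.
by rewrite /= zquot_pi_eq subr0; apply/sub_span/b_im.
Qed.

Definition homology_map : {additive homology d d' -> homology e e'} :=
  zquot_lift homology_map_subproof.

End HomologyMap.

(* The unique homomorphism satisfying P. The value is the zero homomorphism
   unless exactly one homomorphism satisfies P; in the uses below, P expresses
   the defining property of an induced map, and there is exactly one. *)
Definition the_hom (A B : zmodType) (P : set {additive A -> B}) :
    {additive A -> B} :=
  if pselect (exists! h, P h) is left e then projT1 (cid e) else \0.

Lemma additive_ext (A B : zmodType) (f g : {additive A -> B}) : f =1 g -> f = g.
Proof.
case: f g => [f [[fP]]] [g [[gP]]] /= /funext fg; subst g.
by rewrite (Prop_irrelevance fP gP).
Qed.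

Lemma the_homP (A B : zmodType) (P : set {additive A -> B}) h :
  P h -> (forall h', P h' -> h' =1 h) -> the_hom P = h.
Proof.
move=> Ph uPh; rewrite /the_hom; case: pselect => [e|[]].
  by case: (cid e) => h' [/= Ph' _]; apply/additive_ext/uPh.
by exists h; split=> // h' /uPh /additive_ext.
Qed.

(* A diagram of abelian groups over a quiver. No composition law is recorded, since it
   plays no role in the construction of the limit and the colimit. *)
Record diagram := Diagram {
  dob : Type;
  dgrp : dob -> zmodType;
  darr : dob -> dob -> Type;
  dmap : forall i j, darr i j -> {additive dgrp i -> dgrp j} }.

Section Product.
Context (I : Type) (G : I -> zmodType).

Definition zprod := forall i, G i.

HB.instance Definition _ := gen_eqMixin zprod.
HB.instance Definition _ := gen_choiceMixin zprod.

Definition zprod_add (x y : zprod) : zprod := fun i => x i + y i.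
Definition zprod_opp (x : zprod) : zprod := fun i => - x i.
Definition zprod0 : zprod := fun=> 0.

Lemma zprod_addA : associative zprod_add.
Proof. by move=> x y z; apply: functional_extensionality_dep => i; apply: addrA. Qed.
Lemma zprod_addC : commutative zprod_add.
Proof. by move=> x y; apply: functional_extensionality_dep => i; apply: addrC. Qed.
Lemma zprod_add0 : left_id zprod0 zprod_add.
Proof. by move=> x; apply: functional_extensionality_dep => i; apply: add0r. Qed.
Lemma zprod_addN : left_inverse zprod0 zprod_opp zprod_add.
Proof. by move=> x; apply: functional_extensionality_dep => i; apply: addNr. Qed.

HB.instance Definition _ :=
  GRing.isZmodule.Build zprod zprod_addA zprod_addC zprod_add0 zprod_addN.

End Product.

Section Limit.
Context (D : diagram).

Definition lim_pred : {pred zprod (@dgrp D)} :=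
  fun x => `[< forall i j (a : darr i j), dmap a (x i) = x j >].

Lemma lim_pred_zmod_closed : zmod_closed lim_pred.
Proof.
split=> [|x y /asboolP xP /asboolP yP]; apply/asboolP => i j a.
  exact: raddf0.
by rewrite [LHS]raddfB xP yP.
Qed.

HB.instance Definition _ :=
  GRing.isZmodClosed.Build (zprod (@dgrp D)) lim_pred lim_pred_zmod_closed.

Definition limit := {x : zprod (@dgrp D) | x \in lim_pred}.
HB.instance Definition _ := [isSub of limit for @sval _ _].
HB.instance Definition _ := [Choice of limit by <:].
HB.instance Definition _ := [SubChoice_isSubZmodule of limit by <:].

Definition lim_proj (i : dob D) (x : limit) : dgrp i := (val x : zprod (@dgrp D)) i.

Lemma lim_proj_is_additive i : zmod_morphism (lim_proj i).
Proof. by []. Qed.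

HB.instance Definition _ i :=
  GRing.isZmodMorphism.Build limit (dgrp i) (lim_proj i) (lim_proj_is_additive i).

End Limit.

Section Colimit.
Context (D : diagram).

Local Notation gen := {classic {i : dob D & dgrp i}}.

Definition colim_gen i (x : dgrp i) : {freeg gen / int} := << (existT _ i x : gen) >>.

(* The free abelian group on the disjoint union of the groups of D, modulo the
   additivity relations and the identifications imposed by the arrows of D. *)
Definition colim_rel : set {freeg gen / int} :=
  [set r | (exists i (x y : dgrp i),
              r = colim_gen (x + y) - colim_gen x - colim_gen y) \/
           (exists i j (a : darr i j) (x : dgrp i),
              r = colim_gen (dmap a x) - colim_gen x)].

Definition colimit := zquot colim_rel.
HB.instance Definition _ := GRing.Zmodule.on colimit.

Definition colim_in i (x : dgrp i) : colimit := zquot_pi _ (colim_gen x).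

Lemma colim_inD i (x y : dgrp i) : colim_in (x + y) = colim_in x + colim_in y.
Proof.
apply/eqP; rewrite /colim_in -raddfD /= zquot_pi_eq opprD addrA.
by apply/sub_span; left; exists i, x, y.
Qed.

Lemma colim_in_is_additive i : zmod_morphism (@colim_in i).
Proof. by move=> x y; apply/(addIr (colim_in y)); rewrite -colim_inD !subrK. Qed.

HB.instance Definition _ i :=
  GRing.isZmodMorphism.Build (dgrp i) colimit (@colim_in i) (@colim_in_is_additive i).

Lemma colim_inE i j (a : darr i j) (x : dgrp i) : colim_in (dmap a x) = colim_in x.
Proof.
apply/eqP; rewrite /colim_in zquot_pi_eq.
by apply/sub_span; right; exists i, j, a, x.
Qed.

End Colimit.
Arguments lim_proj {D} i.
Arguments colim_in {D} i.

Definition metrizable (R : realType) (X : topologicalType) :=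
  exists d : X -> X -> R,
    [/\ forall x y, d x y = 0 <-> x = y,
        forall x y, d x y = d y x,
        forall x y z, d x z <= d x y + d y z &
        forall x (A : set X),
          nbhs x A <-> exists2 e : R, 0 < e & [set y | d x y < e] `<=` A].

Definition separable (X : topologicalType) :=
  exists2 D : set X, countable D & dense D.

Definition local_compactum (R : realType) (X : topologicalType) :=
  [/\ locally_compact [set: X], separable X & metrizable R X].

Definition homotopic (R : realType) (X Y : topologicalType)
    (f g : continuousType X Y) :=
  exists h : X * R -> Y,
    [/\ {within [set: X] `*` `[0, 1], continuous h},
        forall x, h (x, 0) = f x & forall x, h (x, 1) = g x].

Definition closed_embedding (X Y : topologicalType) (f : X -> Y) :=
  [/\ continuous f, injective f & forall A, closed A -> closed (f @` A)].

(* The retraction is defined on the subspace U as a type of its own, so that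
   the empty space is an ANR. *)
Definition ANR (R : realType) (P : topologicalType) :=
  metrizable R P /\
  forall (M : topologicalType) (i : P -> M), metrizable R M -> closed_embedding i ->
    exists U : set M, [/\ open U, range i `<=` U &
      exists r : continuousType U P, forall (u : U) x, set_val u = i x -> r u = x].

(* Indexed by a directed preorder; homotopy classes of bonding maps are given
   by representatives. *)
Record ANR_expansion (R : realType) (X : topologicalType) := ANRExpansion {
  ex_disp : Order.disp_t;
  ex_idx : preorderType ex_disp;
  ex_sp : ex_idx -> topologicalType;
  ex_bond : forall m l : ex_idx, (m <= l)%O -> continuousType (ex_sp l) (ex_sp m);
  ex_proj : forall l : ex_idx, continuousType X (ex_sp l);
  ex_inhabited : inhabited ex_idx;
  ex_directed : forall l m : ex_idx, exists n, (l <= n)%O /\ (m <= n)%O;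
  ex_ANR : forall l, ANR R (ex_sp l);
  ex_bond_id : forall l (ll : (l <= l)%O), homotopic R (ex_bond ll) idfun;
  ex_bond_comp : forall k m l (km : (k <= m)%O) (ml : (m <= l)%O) (kl : (k <= l)%O),
    homotopic R (ex_bond km \o ex_bond ml) (ex_bond kl);
  ex_proj_bond : forall m l (ml : (m <= l)%O),
    homotopic R (ex_bond ml \o ex_proj l) (ex_proj m);
  ex_E1 : forall (K : topologicalType) (f : continuousType X K), ANR R K ->
    exists l (f' : continuousType (ex_sp l) K), homotopic R f (f' \o ex_proj l);
  ex_E2 : forall (K : topologicalType) k (f g : continuousType (ex_sp k) K),
    ANR R K -> homotopic R (f \o ex_proj k) (g \o ex_proj k) ->
    exists l (kl : (k <= l)%O), homotopic R (f \o ex_bond kl) (g \o ex_bond kl) }.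

Arguments ex_proj {R X} a l.

Record compacts (X : topologicalType) := Compacts {
  cpt_set :> set X;
  cpt_compact : compact cpt_set }.

Section Restriction.
Context (X Y : topologicalType) (f : continuousType X Y) (A : set X) (B : set Y).
Hypothesis fAB : f @` A `<=` B.

Lemma restr_subproof (x : A) : f (set_val x) \in B.
Proof. by apply/mem_set/fAB; exists (set_val x) => //; exact: set_valP. Qed.

Definition restr_fun (x : A) : B := exist _ (f (set_val x)) (restr_subproof x).

Lemma restr_continuous : continuous restr_fun.
Proof.
apply: continuous_comp_initial => x.
apply: (@continuous_comp _ _ _ set_val f); last exact: cts_fun.
exact: (@initial_continuous A X set_val).
Qed.

HB.instance Definition _ := isContinuous.Build A B restr_fun restr_continuous.

Definition restr : continuousType A B := restr_fun.

End Restriction.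

Section Inclusion.
Context (X : topologicalType) (A : set X).

HB.instance Definition _ :=
  isContinuous.Build A X set_val (@initial_continuous A X set_val).

Definition incl : continuousType A X := set_val.

Lemma incl2_subproof (B : set X) : A `<=` B -> idfun @` A `<=` B.
Proof. by rewrite image_id. Qed.

Definition incl2 (B : set X) (AB : A `<=` B) : continuousType A B :=
  restr (incl2_subproof AB).

End Inclusion.

HB.instance Definition _ (A : nzRingType) (K : choiceType) (M : lmodType A) (f : K -> M) :=
  GRing.isZmodMorphism.Build {freeg K / A} M (fglift f) (lift_is_additive f).

Lemma freeg_additive_ext (K : choiceType) (A : zmodType) (f g : {additive {freeg K / int} -> A}) :
  (forall k, f << k >> = g << k >>) -> f =1 g.
Proof.
move=> fg D; rewrite -(freeg_sumE D) !raddf_sum; apply: eq_bigr => k _.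
by rewrite -[coeff k D]intz -freegU_mulz !raddfMz fg.
Qed.

Section Simplex.
Context (R : realType).

Definition simplex n : set 'rV[R]_n.+1 :=
  [set x | (forall i, 0 <= x 0 i) /\ \sum_i x 0 i = 1].

Arguments simplex : clear implicits.

Definition insert0 n (i : 'I_n.+2) (x : 'rV[R]_n.+1) : 'rV[R]_n.+2 :=
  \row_j if unlift i j is Some k then x 0 k else 0.

Lemma insert0_continuous n (i : 'I_n.+2) : continuous (@insert0 n i).
Proof.
move=> x A [P nP PA]; rewrite nbhs_simpl /=.
exists (fun _ k => P 0 (fintype.lift i k)) => [i' k|y Py].
  by have := nP 0 (fintype.lift i k); rewrite mxE liftK (ord1 i').
apply: PA => i' j; rewrite (ord1 i') mxE; case: unliftP => [k ->|->].
  exact: Py.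
by apply: nbhs_singleton; have := nP 0 i; rewrite mxE unlift_none.
Qed.

HB.instance Definition _ n i :=
  isContinuous.Build _ _ (@insert0 n i) (@insert0_continuous n i).

Lemma insert0_simplex n (i : 'I_n.+2) : insert0 i @` simplex n `<=` simplex n.+1.
Proof.
move=> _ [x [x0 x1] <-]; split=> [j|].
  by rewrite mxE; case: unliftP.
rewrite (bigD1_ord i) //= mxE unlift_none add0r -[RHS]x1.
by apply: eq_bigr => k _; rewrite mxE liftK.
Qed.

(* The inclusion of the i-th face of the standard (n+1)-simplex. *)
Definition face n (i : 'I_n.+2) : continuousType (simplex n) (simplex n.+1) :=
  restr (@insert0_simplex n i).

Section Chains.
Context (X : topologicalType).

Definition chain n := {freeg (continuousType (simplex n) X) / int}.

Definition bd_simplex n (s : continuousType (simplex n.+1) X) : chain n :=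
  \sum_(i < n.+2) (-1) ^+ i *: << (s \o face i : continuousType (simplex n) X) >>.

(* The boundary of n-chains, with the convention that it is zero for n = 0. *)
Definition bd n : {additive chain n -> chain n.-1} :=
  match n with 0%N => \0 | m.+1 => fglift (@bd_simplex m) end.

Definition singH n := homology (bd n.+1) (bd n).
HB.instance Definition _ n := GRing.Zmodule.on (singH n).

End Chains.

Section ChainMap.
Context (X Y : topologicalType) (f : continuousType X Y).

Definition push_simplex n (s : continuousType (simplex n) X) : chain Y n :=
  << (f \o s : continuousType (simplex n) Y) >>.

Definition push n : {additive chain X n -> chain Y n} := fglift (@push_simplex n).

Lemma push_bd n (c : chain X n) : push n.-1 (bd X n c) = bd Y n (push n c).
Proof.
case: n c => [|n] c /=; first by rewrite raddf0.
move: c; apply: (freeg_additive_ext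
  (f := push n \o bd X n.+1) (g := bd Y n.+1 \o push n.+1)) => s /=.
rewrite !liftU !scale1r liftU scale1r /bd_simplex raddf_sum; apply: eq_bigr => i _.
rewrite raddfZsign /=; congr (_ *: _); rewrite liftU scale1r /push_simplex.
by congr (<< _ >>); apply/continuousEP.
Qed.

Lemma push_ker n (c : chain X n) : bd X n c = 0 -> bd Y n (push n c) = 0.
Proof. by rewrite -push_bd => ->; rewrite raddf0. Qed.

Lemma push_im n (c : chain X n) :
  range (bd X n.+1) c -> range (bd Y n.+1) (push n c).
Proof. by case=> b _ <-; exists (push n.+1 b); rewrite // -push_bd. Qed.

Definition singH_map n : {additive singH X n -> singH Y n} :=
  homology_map (@push_ker n) (@push_im n).

End ChainMap.
End Simplex.

Section QuasiHomology.
Context (R : realType) (n : nat).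

Definition qH_diagram (X : topologicalType) (E : ANR_expansion R X) : diagram :=
  @Diagram (ex_idx E) (fun l => singH R (ex_sp l) n) (fun l m => (m <= l)%O)
    (fun l m ml => singH_map R (ex_bond ml) n).

Definition qH X (E : ANR_expansion R X) := limit (qH_diagram E).
HB.instance Definition _ X (E : ANR_expansion R X) := GRing.Zmodule.on (qH E).

(* On limits, f is represented by its factorizations, up to homotopy, through
   the terms of the two expansions. *)
Definition qH_map X Y (EX : ANR_expansion R X) (EY : ANR_expansion R Y)
    (f : continuousType X Y) : {additive qH EX -> qH EY} :=
  the_hom [set h : {additive qH EX -> qH EY} |
    forall (l : ex_idx EX) (m : ex_idx EY) (g : continuousType (ex_sp l) (ex_sp m)),
      homotopic R (ex_proj EY m \o f) (g \o ex_proj EX l) ->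
      forall x : qH EX, @lim_proj (qH_diagram EY) m (h x) =
        singH_map R g n (@lim_proj (qH_diagram EX) l x)].

Context (X : topologicalType) (E : ANR_expansion R X).
Context (EK : forall K : compacts X, ANR_expansion R K).

Definition pH_diagram : diagram :=
  @Diagram (compacts X) (fun K => qH (EK K)) (fun K L => K `<=` L)
    (fun K L KL => qH_map (EK K) (EK L) (incl2 KL)).

Definition pH := colimit pH_diagram.
HB.instance Definition _ := GRing.Zmodule.on pH.

Definition tau_homology : {additive pH -> qH E} :=
  the_hom [set h : {additive pH -> qH E} |
    forall (K : compacts X) (x : qH (EK K)),
      h (@colim_in pH_diagram K x) = qH_map (EK K) E (incl K) x].

End QuasiHomology.

(* Covers are sets of open sets rather than indexed families, so that the
   covers of X form a small type. *)
Record open_cover (X : topologicalType) := OpenCover {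
  oc_set :> set (set X);
  oc_open : forall u, oc_set u -> open u;
  oc_cover : forall x, exists2 u, oc_set u & u x }.

Section Nerve.
Context (X : topologicalType) (U : open_cover X).

(* The (ordered, possibly degenerate) n-simplices of the nerve of U. *)
Record nerve_simplex n := NerveSimplex {
  ns_vtx :> 'I_n.+1 -> (U : set (set X));
  ns_meet : exists x, forall i, set_val (ns_vtx i) x }.

Lemma nerve_face_subproof n (i : 'I_n.+2) (v : nerve_simplex n.+1) :
  exists x, forall j, set_val (v (fintype.lift i j)) x.
Proof. by have [x vx] := ns_meet v; exists x. Qed.

Definition nerve_face n (i : 'I_n.+2) (v : nerve_simplex n.+1) : nerve_simplex n :=
  NerveSimplex (nerve_face_subproof i v).

Definition cochain n := nerve_simplex n -> int.
HB.instance Definition _ n := GRing.Zmodule.on (cochain n).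

Definition cobd_fun n (c : cochain n) : cochain n.+1 :=
  fun v => \sum_(i < n.+2) (-1) ^+ i * c (nerve_face i v).

Lemma cobd_fun_is_additive n : zmod_morphism (@cobd_fun n).
Proof.
move=> c d; apply/funext => v; rewrite /cobd_fun -[RHS]sumrB.
by apply: eq_bigr => i _; rewrite -mulrBr.
Qed.

HB.instance Definition _ n := GRing.isZmodMorphism.Build (cochain n) (cochain n.+1)
  (@cobd_fun n) (@cobd_fun_is_additive n).

Definition cobd n : {additive cochain n -> cochain n.+1} := @cobd_fun n.

(* The coboundary into n-cochains, with the convention that it is zero for n = 0. *)
Definition cobd_in n : {additive cochain n.-1 -> cochain n} :=
  match n with 0%N => \0 | m.+1 => cobd m end.

Definition nerveH n := homology (cobd_in n) (cobd n).
HB.instance Definition _ n := GRing.Zmodule.on (nerveH n).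

End Nerve.

(* A choice, for each w in W, of a member of U containing f(w). For f = id this
   is a refinement projection. *)
Record cover_map (X Y : topologicalType) (f : continuousType X Y)
    (W : open_cover X) (U : open_cover Y) := CoverMap {
  cm_fun :> (W : set (set X)) -> (U : set (set Y));
  cm_sub : forall w, f @` set_val w `<=` set_val (cm_fun w) }.

Section CoverMap.
Context (X Y : topologicalType) (f : continuousType X Y).
Context (W : open_cover X) (U : open_cover Y) (p : cover_map f W U).

Lemma nerve_push_subproof n (v : nerve_simplex W n) :
  exists y, forall i, set_val (p (v i)) y.
Proof. by have [x vx] := ns_meet v; exists (f x) => i; apply: cm_sub; exists x. Qed.

Definition nerve_push n (v : nerve_simplex W n) : nerve_simplex U n :=
  NerveSimplex (nerve_push_subproof v).

Definition pull_fun n (c : cochain U n) : cochain W n := c \o @nerve_push n.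

Lemma pull_fun_is_additive n : zmod_morphism (@pull_fun n).
Proof. by []. Qed.

HB.instance Definition _ n := GRing.isZmodMorphism.Build (cochain U n) (cochain W n)
  (@pull_fun n) (@pull_fun_is_additive n).

Definition pull n : {additive cochain U n -> cochain W n} := @pull_fun n.

Lemma pull_cobd n (c : cochain U n) : pull n.+1 (cobd U n c) = cobd W n (pull n c).
Proof.
apply/funext => v; apply: eq_bigr => i _; congr (_ * c _).
by rewrite /nerve_face /nerve_push /=; congr NerveSimplex; apply: Prop_irrelevance.
Qed.

Lemma pull_ker n (c : cochain U n) : cobd U n c = 0 -> cobd W n (pull n c) = 0.
Proof. by rewrite -pull_cobd => ->; rewrite raddf0. Qed.

Lemma pull_im n (c : cochain U n) :
  range (cobd_in U n) c -> range (cobd_in W n) (pull n c).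
Proof.
case: n c => [|n] c [b _ <-]; first by exists 0; rewrite //= raddf0.
by exists (pull n b); rewrite // -pull_cobd.
Qed.

Definition nerveH_map n : {additive nerveH U n -> nerveH W n} :=
  homology_map (@pull_ker n) (@pull_im n).

End CoverMap.

Section Cech.
Context (n : nat).

Definition cech_diagram (X : topologicalType) : diagram :=
  @Diagram (open_cover X) (fun U => nerveH U n)
    (fun U V => cover_map (idfun : continuousType X X) V U)
    (fun U V p => nerveH_map p n).

Definition cechH X := colimit (cech_diagram X).
HB.instance Definition _ X := GRing.Zmodule.on (cechH X).

(* On representatives, f acts by pulling back along any choice of a cover W of X
   refining the preimage of U, and of a map W -> U witnessing this. *)
Definition cechH_map (X Y : topologicalType) (f : continuousType X Y) :
    {additive cechH Y -> cechH X} :=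
  the_hom [set h : {additive cechH Y -> cechH X} |
    forall (U : open_cover Y) (W : open_cover X) (p : cover_map f W U) (c : nerveH U n),
      h (@colim_in (cech_diagram Y) U c) =
      @colim_in (cech_diagram X) W (nerveH_map p n c)].

Definition qcoH_diagram (X : topologicalType) : diagram :=
  @Diagram (compacts X) (fun K => cechH K) (fun L K => K `<=` L)
    (fun L K KL => cechH_map (incl2 KL)).

Definition qcoH X := limit (qcoH_diagram X).
HB.instance Definition _ X := GRing.Zmodule.on (qcoH X).

Definition qcoH_map (X Y : topologicalType) (f : continuousType X Y) :
    {additive qcoH Y -> qcoH X} :=
  the_hom [set h : {additive qcoH Y -> qcoH X} |
    forall (K : compacts X) (L : compacts Y) (fKL : f @` K `<=` L) (z : qcoH Y),
      @lim_proj (qcoH_diagram X) K (h z) =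
      cechH_map (restr fKL) (@lim_proj (qcoH_diagram Y) L z)].

Context (R : realType) (X : topologicalType) (E : ANR_expansion R X).

Definition pcoH_diagram : diagram :=
  @Diagram (ex_idx E) (fun l => qcoH (ex_sp l)) (fun m l => (m <= l)%O)
    (fun m l ml => qcoH_map (ex_bond ml)).

Definition pcoH := colimit pcoH_diagram.
HB.instance Definition _ := GRing.Zmodule.on pcoH.

Definition tau_cohomology : {additive pcoH -> qcoH X} :=
  the_hom [set h : {additive pcoH -> qcoH X} |
    forall (l : ex_idx E) (x : qcoH (ex_sp l)),
      h (@colim_in pcoH_diagram l x) = qcoH_map (ex_proj E l) x].

End Cech.

(* Main.v *)
Require Import Defs.
From HB Require Import structures.
From mathcomp Require Import all_boot all_order all_algebra.
From mathcomp Require Import all_classical all_reals all_analysis.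
From mathcomp Require Import lra zify.
From mathcomp.multinomials Require Import freeg.

Set Implicit Arguments.
Unset Strict Implicit.
Unset Printing Implicit Defensive.

Import Order.TTheory GRing.Theory Num.Theory.
Import numFieldNormedType.Exports.

Local Open Scope classical_set_scope.
Local Open Scope ring_scope.

(** In degree 0 both halves of the theorem are about locally constant
    functions; write C(X, G) for those on X with values in the group G.

    Cohomology.  The Čech group H^0(K) is C(K, Z) ([cech_fun]), so that
    qH^0(X) consists of the functions X -> Z which are locally constant on every
    compactum in X.  When X is metrizable these are just the elements of C(X, Z),
    because a convergent sequence together with its limit is compact
    ([compactly_locally_constantW]).  Homotopic maps pull a locally constant
    function back to the same function, and discrete spaces are ANRs
    ([discrete_ANR]).  Hence (E1) for maps to the discrete space Z says that every
    element of C(X, Z) is pulled back from some term of the expansion, and (E2)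
    that an element of C(P_l, Z) whose pullback to X is 0 already becomes 0 on
    a further term.  These are the surjectivity and the injectivity of the map
    from the colimit of the C(P_l, Z) to C(X, Z).

    Homology.  For an ANR P the path components are open
    ([point_class_locally_constant]), so a class in H_0(P) is determined by its
    pairings with the elements of C(P, Z) ([singH0_separation]).  By (E1) and
    (E2) for discrete groups G, a class y in qH_0(X) therefore assigns to each phi
    in C(X, G) a value [evaluation y phi] in G, additively in phi and naturally
    in G, and y is determined by its values for G = Z ([qH_ext]).  To find
    a class on a compactum K which maps to y:

    - Some compact K supports y: if phi vanishes on K, its value is 0
      ([evaluation_compact_support]).  Otherwise take an exhaustion by compacta
      and phi_i vanishing on the i-th of them with nonzero value.  The sum of the
      phi_i 'X^i is locally finite, so it lies in C(X, Z['X]), and its value would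
      be a polynomial with infinitely many nonzero coefficients.

    - The values of y thus define a homomorphism to Z on the subgroup of C(K, Z)
      formed by the restrictions of elements of C(X, Z).  It extends to C(K, Z)
      ([evaluation_extension]): as K has a countable base, C(K, Z) lies in the union
      of a sequence of groups of functions on K which starts with this subgroup and
      adjoins one function at a time.  At each stage the group obtained so far is
      pure ([factoring_pure]), so that either the new function is in it already,
      or no nonzero multiple of it is and the value there can be chosen freely.

    - Every homomorphism C(K, Z) -> Z is evaluation at a class in qH_0(K)
      ([qH_realization]): a map p from K to an ANR Q meets finitely many path
      components of Q, and the class to take in H_0(Q) weights each component
      with the value at the indicator function of its preimage.

    The image in qH_0(X) of the class found in this way has the same values as y. *)

(** * Locally constant functions and discrete ANRs *)

Definition locally_constant (X : topologicalType) (G : Type) (f : X -> G) :=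
  forall x, \forall y \near x, f y = f x.

Lemma locally_constant_cst (X : topologicalType) (G : Type) (g : G) :
  locally_constant (fun _ : X => g).
Proof. by move=> x; apply: nearW. Qed.

Lemma locally_constant_comp (X Y : topologicalType) (G : Type) (f : X -> Y) (phi : Y -> G) :
  continuous f -> locally_constant phi -> locally_constant (phi \o f).
Proof. by move=> fc phic x; exact: (fc x _ (phic (f x))). Qed.

Lemma locally_constant_map (X : topologicalType) (G H : Type) (u : G -> H) (phi : X -> G) :
  locally_constant phi -> locally_constant (u \o phi).
Proof. by move=> phic x; near=> y; congr u; near: y; exact: phic. Unshelve. all: by end_near. Qed.

Lemma locally_constant_map2 (X : topologicalType) (G H K : Type) (u : G -> H -> K)
    (phi : X -> G) (psi : X -> H) :
  locally_constant phi -> locally_constant psi ->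
  locally_constant (fun x => u (phi x) (psi x)).
Proof.
move=> phic psic x; near=> y; congr u; near: y; [exact: phic|exact: psic].
Unshelve. all: by end_near. Qed.

Lemma locally_constant_discrete (X : topologicalType) (G : choiceType)
    (phi : X -> discrete_topology G) :
  continuous phi <-> locally_constant phi.
Proof.
split=> phic x; first by have /discrete_cvg := phic x; apply.
by apply/discrete_cvg; apply: (filterS _ (phic x)).
Qed.

Lemma set_val_continuous (X : topologicalType) (A : set X) :
  continuous (set_val : A -> X).
Proof. exact: (@initial_continuous A X set_val). Qed.

Section Discrete.
Context (X : topologicalType) (G : choiceType) (phi : X -> G).
Hypothesis phic : locally_constant phi.
(** A name of its own for phi, with the discrete topology on its codomain, on
    which a structure of continuous map can be declared. *)
Definition to_discrete : X -> discrete_topology G := phi.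
Lemma to_discrete_continuous : continuous to_discrete.
Proof. exact/locally_constant_discrete. Qed.
HB.instance Definition _ :=
  isContinuous.Build X (discrete_topology G) to_discrete to_discrete_continuous.
Definition discrete_map : continuousType X (discrete_topology G) := to_discrete.
End Discrete.

Lemma discrete_map_locally_constant (X : topologicalType) (G : choiceType)
    (f : continuousType X (discrete_topology G)) :
  locally_constant (f : X -> G).
Proof. exact/locally_constant_discrete/cts_fun. Qed.

Record metric (R : realType) (T : Type) := Metric {
  mt_dist :> T -> T -> R;
  mt_distxx : forall x, mt_dist x x = 0;
  mt_dist_eq0 : forall x y, mt_dist x y = 0 -> x = y;
  mt_sym : forall x y, mt_dist x y = mt_dist y x;
  mt_triangle : forall x y z, mt_dist x z <= mt_dist x y + mt_dist y z }.

Lemma mt_ge0 (R : realType) (T : Type) (d : metric R T) x y : 0 <= d x y.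
Proof.
by have := mt_triangle d x y x; rewrite mt_distxx (mt_sym d y x); lra.
Qed.

Section Connectedness.
Context (R : realType).

(** A locally constant function splits the space into two clopen parts, the fibre
    of phi (g 0) and the rest. The intermediate value theorem applied to the
    indicator of that fibre along g shows that the path cannot leave it. *)
Lemma locally_constant_path (Y : topologicalType) (G : Type) (g : R -> Y) (phi : Y -> G) :
  {within `[0, 1], continuous g} -> locally_constant phi -> phi (g 0) = phi (g 1).
Proof.
move=> gc phic.
pose u (y : Y) : R := (`[< phi y = phi (g 0) >])%:R.
have uc : continuous u.
  move=> y A uA; have /= := phic y; apply: filterS => z zy.
  by change (A (u z)); rewrite /u zy; exact: nbhs_singleton uA.
have ugc : {within `[0, 1], continuous (u \o g)}.
  by apply: within_continuous_comp => // x _; exact: uc.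
have u0 : u (g 0) = 1 by rewrite /u asboolT.
have [//|ne] := pselect (phi (g 0) = phi (g 1)).
have u1 : u (g 1) = 0 by rewrite /u asboolF // => /esym.
have [|c _ /=] := @IVT R (u \o g) 0 1 (1 / 2) ler01 ugc.
  by rewrite /= u0 u1 ge_min le_max; apply/andP; split; apply/orP; [right|left]; clear -R; lra.
by rewrite /u => cb; exfalso; move: (asbool _) cb => b; clear; case: b => /=; lra.
Qed.

Lemma homotopy_path (X Y : topologicalType) (h : X * R -> Y) x :
  {within [set: X] `*` `[0, 1], continuous h} ->
  {within `[0, 1], continuous (fun t => h (x, t))}.
Proof.
move=> /subspace_sigL_continuousP hc.
apply/subspace_sigL_continuousP => t A /= hA.
have xt s : s \in `[0, 1]%classic -> (x, s) \in [set: X] `*` `[0, 1 : R]%classic.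
  by rewrite !inE.
have [_ [[C oC <-] /= Cx CA]] := hc (exist _ (x, set_val t) (xt _ (valP t))) A hA.
have : nbhs t (set_val @^-1` ((fun t : R => (x, t)) @^-1` C)).
  apply: set_val_continuous.
  have [[P Q] /= [Px Qt] PQ] : nbhs (x, set_val t) C by exact: open_nbhs_nbhs.
  by apply: filterS Qt => s Qs; apply: PQ; split=> //; exact: nbhs_singleton.
by apply: filterS => s Cs; exact: (CA (exist _ (x, set_val s) (xt _ (valP s)))).
Qed.

Lemma homotopic_locally_constant (X Y : topologicalType) (f g : continuousType X Y)
    (G : Type) (phi : Y -> G) :
  homotopic R f g -> locally_constant phi -> phi \o f =1 phi \o g.
Proof.
move=> [h [hc h0 h1]] phic x; rewrite /= -h0 -h1.
by apply: (@locally_constant_path _ _ (fun t => h (x, t))) => //; exact: homotopy_path.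
Qed.

Lemma homotopic_discrete (X : topologicalType) (T : choiceType)
    (f g : continuousType X (discrete_topology T)) :
  homotopic R f g -> f =1 g.
Proof.
move=> fg; apply: (homotopic_locally_constant (phi := idfun) fg) => t.
exact: discrete_set1.
Qed.

Lemma homotopic_refl (X Y : topologicalType) (f g : continuousType X Y) :
  f =1 g -> homotopic R f g.
Proof.
move=> fg; exists (fun z => f z.1); split => //.
apply: continuous_subspaceT => z.
by apply: (@continuous_comp _ _ _ fst f); [exact: cvg_fst|exact: cts_fun].
Qed.

Lemma metrizableP (X : topologicalType) : metrizable R X ->
  exists d : metric R X, forall x (A : set X),
    nbhs x A <-> exists2 e : R, 0 < e & [set y | d x y < e] `<=` A.
Proof.
move=> [d [d0 ds dt dn]].
have dxx x : d x x = 0 by exact/d0.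
have deq x y : d x y = 0 -> x = y by move/d0.
by exists (Metric dxx deq ds dt).
Qed.

Lemma metric_metrizable (M : metricType R) : metrizable R M.
Proof.
exists mdist; split.
- by move=> x y; split=> [/mdist_positivity|->] //; exact: mdistxx.
- exact: metric_sym.
- exact: metric_triangle.
- move=> x A; rewrite -nbhs_ballE /nbhs_ball /nbhs_ball_ /filter_from.
  by split=> [[e e0]|[e e0]]; rewrite ?ballEmdist /=; exists e => //=; rewrite ?ballEmdist.
Qed.

Lemma discrete_metrizable (T : choiceType) : metrizable R (discrete_topology T).
Proof.
exists (fun x y => (x != y)%:R : R); split.
- move=> x y; case: eqVneq => [->|/eqP n]; first by split.
  by split=> // /eqP; rewrite oner_eq0.
- by move=> x y; rewrite eq_sym.
- move=> x y z; case: (eqVneq x z) => [->|n] /=; first exact: addr_ge0.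
  by case: (eqVneq x y) n => [->|_] /= n; rewrite ?n /= ?add0r // lerDl.
- move=> x A; rewrite nbhs_principalE; split=> [/principal_filterP Ax|[e e0 eA]].
    by exists 1 => // y /=; case: eqVneq => [<-|] //; rewrite ltxx.
  by apply/principal_filterP/eA; rewrite /= eqxx.
Qed.

(** Around every point of a closed discrete subset of a metric space take the
    ball whose radius is half the distance to the rest of the subset. These
    balls are disjoint, and the retraction collapses each to its centre. *)
Lemma discrete_ANR (T : choiceType) : ANR R (discrete_topology T).
Proof.
split; first exact: discrete_metrizable.
move=> M i /metrizableP[d dn] [ic ii icl].
have d0 := mt_distxx d; have ds := mt_sym d; have dt := mt_triangle d.
have sep x : {e : R | 0 < e & forall y, d (i x) (i y) < e -> y = x}.
  apply: cid2.
  have oC : open (~` (i @` [set~ x])).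
    by rewrite openC; apply: icl; exact: (@discrete_closed (discrete_topology T)).
  have [|e e0 eP] := (dn (i x) (~` (i @` [set~ x]))).1.
    by apply: open_nbhs_nbhs; split=> // -[y yx /ii]; exact: yx.
  by exists e => // y /eP ny; apply: contrapT => yx; apply: ny; exists y.
pose e x : R := s2val (sep x).
have e0 x : 0 < e x by exact: (s2valP (sep x)).
have eP x y : d (i x) (i y) < e x -> y = x by exact: (s2valP' (sep x)).
pose B x := [set y | d (i x) y < e x / 2].
have B_uniq m x y : B x m -> B y m -> x = y.
  rewrite /B /= => xm ym.
  have xy : d (i x) (i y) < (e x + e y) / 2.
    by have := dt (i x) m (i y); rewrite (ds m); lra.
  have [le|lt] := leP (e y) (e x); [apply/esym/eP|apply/eP; rewrite ds]; lra.
have B_open x : open (B x).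
  rewrite openE => m Bm; apply/dn; exists (e x / 2 - d (i x) m); first by rewrite subr_gt0.
  by move=> m' /= mm'; rewrite /B /=; have := dt (i x) m m'; lra.
pose U := \bigcup_x B x.
have BU (m : U) : {x | B x (set_val m)}.
  by apply: cid; have [x _ xm] := set_valP m; exists x.
exists U; split.
- exact: bigcup_open.
- move=> _ [x _ <-]; exists x => //; rewrite /B /= d0.
  by have := e0 x; lra.
have Bnbhs (m : U) : nbhs (set_val m) (B (sval (BU m))).
  by apply: open_nbhs_nbhs; split; [exact: B_open|exact: (svalP (BU m))].
have rlc : locally_constant (fun m : U => sval (BU m)).
  move=> m; have : nbhs m (set_val @^-1` B (sval (BU m))).
    exact: (set_val_continuous (Bnbhs m)).
  apply: filterS => m' Bm'.
  by apply: (@B_uniq (set_val m')) => //; exact: (svalP (BU m')).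
exists (discrete_map rlc) => u x ux.
apply: (@B_uniq (set_val u)); first exact: (svalP (BU u)).
by rewrite ux /B /= d0; have := e0 x; lra.
Qed.

End Connectedness.

(** * Colimits of abelian groups *)

Lemma zquot_surj (G : zmodType) (S : set G) (z : zquot S) : exists x, z = zquot_pi S x.
Proof. by exists (repr z); rewrite /zquot_pi reprK. Qed.

Section Algebra.

(** This turns an embedding in a group of functions into a tool for constructing
    homomorphisms: those between the Čech or quasi-cohomology groups below are
    obtained from homomorphisms between groups of functions. *)
Lemma additive_factor (A B G : zmodType) (i : {additive A -> G}) (g : {additive B -> G}) :
  injective i -> (forall b, exists a, i a = g b) ->
  exists h : {additive B -> A}, forall b, i (h b) = g b.
Proof.
move=> i_inj ig; pose h b := sval (cid (ig b)).
have hE b : i (h b) = g b by exact: (svalP (cid (ig b))).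
have h_add : zmod_morphism h by move=> x y; apply: i_inj; rewrite raddfB !hE raddfB.
pose h' : {additive B -> A} := HB.pack h (GRing.isZmodMorphism.Build _ _ h h_add).
by exists h'.
Qed.

Context (D : diagram).

Lemma colim_desc (G : zmodType) (f : forall i : dob D, {additive dgrp i -> G}) :
  (forall i j (a : darr i j) x, f j (dmap a x) = f i x) ->
  exists h : {additive colimit D -> G}, forall i x, h (colim_in i x) = f i x.
Proof.
move=> fE.
(* [zmodule G] is G as a module over int, the form in which maps out of a free
   abelian group are given. *)
pose g0 (k : {classic {i : dob D & dgrp i}}) : zmodule G :=
  f (projT1 k) (projT2 k).
pose g : {additive {freeg {classic {i : dob D & dgrp i}} / int} -> zmodule G} := fglift g0.
have gE i (x : dgrp i) : g (colim_gen x) = f i x.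
  by rewrite /g /colim_gen /= liftU scale1r.
have gS r : colim_rel r -> g r = 0.
  case=> [[i [x [y ->]]]|[i [j [a [x ->]]]]]; rewrite !raddfB !gE.
    by rewrite raddfD /= addrAC addrK subrr.
  by rewrite fE subrr.
exists (zquot_lift gS : {additive zquot _ -> zmodule G}) => i x.
exact: (etrans (zquot_liftE gS _) (gE i x)).
Qed.

Lemma colim_ext (G : zmodType) (h h' : {additive colimit D -> G}) :
  (forall i x, h (colim_in i x) = h' (colim_in i x)) -> h =1 h'.
Proof.
move=> hh' z; have [w ->] := zquot_surj z; move: w.
apply: (@freeg_additive_ext _ _ (h \o zquot_pi _) (h' \o zquot_pi _)) => -[i x].
exact: hh'.
Qed.

Lemma colim_directed : inhabited (dob D) ->
  (forall i j : dob D, exists k, inhabited (darr i k) /\ inhabited (darr j k)) ->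
  forall z : colimit D, exists i x, z = colim_in i x.
Proof.
move=> [i0] dir z; have [w ->] := zquot_surj z; rewrite -(freeg_sumE w) raddf_sum.
elim/big_ind: _ => [|_ _ [i [x ->]] [j [y ->]]|[i x] _].
- by exists i0, 0; rewrite raddf0.
- have [k [[a] [b]]] := dir i j.
  by exists k, (dmap a x + dmap b y); rewrite raddfD /= !colim_inE.
- exists i, (x *~ coeff (existT _ i x : {classic _}) w).
  by rewrite raddfMz /= -[coeff _ w in LHS]intz -freegU_mulz raddfMz.
Qed.

End Algebra.

(** * Čech and quasi-cohomology in degree 0 *)

Section CechZero.

Section Cover.
Context (X : topologicalType) (U : open_cover X).

Lemma nerve_vertex_subproof x (u : (U : set (set X))) : set_val u x ->
  exists y, forall _ : 'I_1, set_val u y.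
Proof. by exists x. Qed.

Definition nerve_vertex x (u : (U : set (set X))) (ux : set_val u x) : nerve_simplex U 0 :=
  NerveSimplex (nerve_vertex_subproof ux).

Lemma nerve_simplex_ext n (v w : nerve_simplex U n) : v =1 w -> v = w.
Proof.
case: v w => [v vP] [w wP] /= /funext vw; subst w.
by congr NerveSimplex; apply: Prop_irrelevance.
Qed.

(** Vertices with a common point span an edge of the nerve, and a 0-cocycle has the
    same value at both ends of an edge. *)
Lemma cocycle0_eq (c : zcycle (cobd U 0)) (v w : nerve_simplex U 0) x :
  set_val (v ord0) x -> set_val (w ord0) x -> val c v = val c w.
Proof.
move=> vx wx.
pose e (i : 'I_2) := if i == ord0 then v ord0 else w ord0.
have eP : exists y, forall i, set_val (e i) y.
  by exists x => i; rewrite /e; case: ifP.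
have /eqP/(congr1 (fun k : cochain U 1 => k (NerveSimplex eP))) := valP c.
rewrite /= /cobd_fun !big_ord_recl big_ord0 /= expr0 mul1r.
rewrite /bump /= addr0 expr1 mulN1r.
have -> : nerve_face ord0 (NerveSimplex eP) = w.
  by apply: nerve_simplex_ext => i; rewrite /= /e (ord1 i).
have -> : nerve_face (fintype.lift ord0 ord0) (NerveSimplex eP) = v.
  by apply: nerve_simplex_ext => i; rewrite /= /e (ord1 i).
by move=> /eqP; rewrite subr_eq0 => /eqP.
Qed.

Lemma cover_at x : {u : (U : set (set X)) | set_val u x}.
Proof.
apply: cid; have [u Uu ux] := oc_cover U x.
by exists (exist _ u (mem_set Uu)).
Qed.

Definition vertex_at x : nerve_simplex U 0 := nerve_vertex (svalP (cover_at x)).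

(** By [cocycle0_eq] a 0-cocycle has the same value on all members of the cover
    that contain a given point, so the choice made in [vertex_at] does not matter. *)
Definition cocycle_fun (c : zcycle (cobd U 0)) : X -> int := fun x => val c (vertex_at x).

Lemma cocycle_fun_is_additive : zmod_morphism cocycle_fun.
Proof. by []. Qed.

HB.instance Definition _ := GRing.isZmodMorphism.Build _ _ cocycle_fun cocycle_fun_is_additive.

Lemma cocycle_fun_eq0 (c : zcycle (cobd U 0)) : range (cobd_in U 0) (val c) -> cocycle_fun c = 0.
Proof. by case=> b _ c0; apply/funext => x; rewrite /cocycle_fun -c0. Qed.

Definition nerve_fun : {additive nerveH U 0 -> (X -> int)} := zquot_lift cocycle_fun_eq0.

Lemma nerve_funE (c : zcycle (cobd U 0)) (v : nerve_simplex U 0) x : set_val (v ord0) x ->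
  nerve_fun (zquot_pi _ c) x = val c v.
Proof.
move=> vx; have -> : nerve_fun (zquot_pi _ c) = cocycle_fun c by exact: zquot_liftE.
by apply: (@cocycle0_eq c _ _ x) => //; exact: (svalP (cover_at x)).
Qed.

Lemma nerveHP (z : nerveH U 0) : exists c : zcycle (cobd U 0), z = zquot_pi _ c.
Proof. exact: zquot_surj. Qed.

(** A vertex of the nerve is a nonempty member of the cover, so its value is seen
    at one of its points. *)
Lemma nerve_fun_inj : injective nerve_fun.
Proof.
apply: raddf_inj => z; have [c ->] := nerveHP z => c0.
suff -> : c = 0 by rewrite raddf0.
apply: val_inj; apply/funext => v /=; have [x vx] := ns_meet v.
by rewrite -(nerve_funE c (vx ord0)) c0.
Qed.

Lemma nerve_fun_locally_constant z : locally_constant (nerve_fun z).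
Proof.
move=> x; have [c ->] := nerveHP z.
have [u ux] := cover_at x.
have : nbhs x (set_val u).
  by apply: open_nbhs_nbhs; split=> //; apply: (oc_open (o := U)); exact: set_valP.
apply: filterS => y uy.
by rewrite (@nerve_funE c (nerve_vertex ux) x)// (@nerve_funE c (nerve_vertex ux) y).
Qed.

End Cover.
#[global] Arguments nerve_fun {X U}.

Lemma nerve_fun_map (X Y : topologicalType) (f : continuousType X Y)
    (W : open_cover X) (U : open_cover Y) (p : cover_map f W U) (z : nerveH U 0) :
  nerve_fun (nerveH_map p 0 z) = nerve_fun z \o f.
Proof.
apply/funext => x; have [c ->] := nerveHP z.
have -> : nerveH_map p 0 (zquot_pi _ c) = zquot_pi _ (zcycle_map (@pull_ker _ _ _ _ _ p 0) c).
  exact: zquot_liftE.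
have [w wx] := cover_at W x.
rewrite (@nerve_funE _ _ _ (nerve_vertex wx)) //; symmetry.
apply: (@nerve_funE _ _ c (nerve_push p (nerve_vertex wx))).
by apply: cm_sub; exists x.
Qed.

(** The preimages of the members of U form a cover W. Different members may have
    the same preimage, so the map from W to U is a choice. *)
Lemma cover_map_preimage (X Y : topologicalType) (f : continuousType X Y) (U : open_cover Y) :
  exists (W : open_cover X), inhabited (cover_map f W U).
Proof.
have Wo w : [set f @^-1` u | u in (U : set (set Y))] w -> open w.
  by case=> u Uu <-; apply: open_comp; [move=> x _; exact: cts_fun|exact: (oc_open Uu)].
have Wc x : exists2 w, [set f @^-1` u | u in (U : set (set Y))] w & w x.
  by have [u Uu ux] := oc_cover U (f x); exists (f @^-1` u) => //; exists u.
pose W := OpenCover Wo Wc; exists W.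
have ch (w : (W : set (set X))) : {u : (U : set (set Y)) | f @` set_val w `<=` set_val u}.
  apply: cid; have [u Uu uw] := set_valP w.
  by exists (exist _ u (mem_set Uu)); move=> _ [x wx <-]; have : (f @^-1` u) x by rewrite uw.
by split; exists (fun w => sval (ch w)) => w; exact: (svalP (ch w)).
Qed.

Lemma cover_map_refinement (X : topologicalType) (U V : open_cover X) :
  exists W, inhabited (cover_map (idfun : continuousType X X) W U) /\
            inhabited (cover_map (idfun : continuousType X X) W V).
Proof.
pose S := [set u `&` v | u in (U : set (set X)) & v in (V : set (set X))].
have So w : S w -> open w.
  by case=> u Uu [v Vv <-]; apply: openI; [exact: (oc_open Uu)|exact: (oc_open Vv)].
have Sc x : exists2 w, S w & w x.
  have [u Uu ux] := oc_cover U x; have [v Vv vx] := oc_cover V x.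
  by exists (u `&` v) => //; exists u => //; exists v.
pose W := OpenCover So Sc; exists W.
have chU (w : (W : set (set X))) : {u : (U : set (set X)) | set_val w `<=` set_val u}.
  apply: cid; have [u Uu [v Vv uw]] := set_valP w.
  by exists (exist _ u (mem_set Uu)); move=> x wx; have [] : (u `&` v) x by rewrite uw.
have chV (w : (W : set (set X))) : {u : (V : set (set X)) | set_val w `<=` set_val u}.
  apply: cid; have [u Uu [v Vv uw]] := set_valP w.
  by exists (exist _ v (mem_set Vv)); move=> x wx; have [] : (u `&` v) x by rewrite uw.
split; split.
  by exists (fun w => sval (chU w)) => w; rewrite image_id; exact: (svalP (chU w)).
by exists (fun w => sval (chV w)) => w; rewrite image_id; exact: (svalP (chV w)).
Qed.

Definition trivial_cover (X : topologicalType) : open_cover X.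
Proof.
exists [set [set: X]] => [u ->|x]; first exact: openT.
by exists setT.
Defined.

Lemma cech_fun_ex (X : topologicalType) :
  exists h : {additive cechH 0 X -> (X -> int)},
    forall U (c : nerveH U 0), h (@colim_in (cech_diagram 0 X) U c) = nerve_fun c.
Proof.
apply: (@colim_desc (cech_diagram 0 X) _ (fun U => nerve_fun (U := U))) => U V p c.
exact: (nerve_fun_map (f := idfun : continuousType X X) p c).
Qed.

Definition cech_fun (X : topologicalType) : {additive cechH 0 X -> (X -> int)} :=
  sval (cid (cech_fun_ex X)).

#[global] Arguments cech_fun {X}.

Lemma cech_funE (X : topologicalType) (U : open_cover X) (c : nerveH U 0) :
  cech_fun (@colim_in (cech_diagram 0 X) U c : cechH 0 X) = nerve_fun c.
Proof. exact: (svalP (cid (cech_fun_ex X))). Qed.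

Lemma cechHP (X : topologicalType) (z : cechH 0 X) :
  exists U (c : nerveH U 0), z = @colim_in (cech_diagram 0 X) U c.
Proof.
apply: (@colim_directed (cech_diagram 0 X)); first by split; exact: trivial_cover.
exact: cover_map_refinement.
Qed.

Lemma cech_fun_inj (X : topologicalType) : injective (@cech_fun X).
Proof.
apply: raddf_inj => z; have [U [c ->]] := cechHP z.
rewrite cech_funE -[X in _ = X -> _](raddf0 (@nerve_fun X U)) => /nerve_fun_inj ->.
by rewrite raddf0.
Qed.

Lemma cech_fun_locally_constant (X : topologicalType) (z : cechH 0 X) :
  locally_constant (cech_fun z).
Proof.
by have [U [c ->]] := cechHP z; rewrite cech_funE; exact: nerve_fun_locally_constant.
Qed.

(** The fibres of a locally constant function form an open cover on whose nerve it is
    a 0-cocycle. *)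
Lemma cech_fun_surj (X : topologicalType) (phi : X -> int) :
  locally_constant phi -> exists z, cech_fun z = phi.
Proof.
move=> phic.
have Uo u : range (fun n => phi @^-1` [set n]) u -> open u.
  by case=> n _ <-; rewrite openE => x <-; exact: phic.
have Uc x : exists2 u, range (fun n => phi @^-1` [set n]) u & u x.
  by exists (phi @^-1` [set phi x]) => //; exists (phi x).
pose U := OpenCover Uo Uc.
pose c (v : nerve_simplex U 0) : int := phi (sval (cid (ns_meet v))).
have cE (v : nerve_simplex U 0) x : set_val (v ord0) x -> c v = phi x.
  move=> vx; rewrite /c; case: cid => y /= /(_ ord0) vy.
  have [n _ nv] := set_valP (v ord0).
  have : (phi @^-1` [set n]) x by rewrite nv.
  by have : (phi @^-1` [set n]) y; [rewrite nv; exact: vy | move=> /= -> ->].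
have cz : (c : cochain U 0) \in zker (cobd U 0).
  apply/eqP/funext => v; rewrite /= /cobd_fun !big_ord_recl big_ord0 /=.
  have [x vx] := ns_meet v.
  rewrite !(cE _ x) /=; try exact: vx.
  by rewrite addr0 expr0 mul1r /bump /= expr1 mulN1r subrr.
pose z : zcycle (cobd U 0) := exist (fun b => b \in zker (cobd U 0)) (c : cochain U 0) cz.
exists (@colim_in (cech_diagram 0 X) U (zquot_pi _ z : nerveH U 0)).
rewrite cech_funE; apply/funext => x; have [u ux] := cover_at U x.
by rewrite (@nerve_funE _ _ _ (nerve_vertex ux)) //=; exact: cE.
Qed.

(** This identifies the induced map, which is given only by its characteristic
    property: existence comes from [additive_factor], uniqueness from the fact that
    every open cover pulls back to one. *)
Lemma cech_fun_map (X Y : topologicalType) (f : continuousType X Y) (z : cechH 0 Y) :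
  cech_fun (cechH_map 0 f z) = cech_fun z \o f.
Proof.
have g_add : zmod_morphism (fun z : cechH 0 Y => cech_fun z \o f).
  by move=> x y; rewrite raddfB.
pose g : {additive cechH 0 Y -> (X -> int)} :=
  HB.pack (fun z : cechH 0 Y => cech_fun z \o f)
    (GRing.isZmodMorphism.Build _ _ (fun z : cechH 0 Y => cech_fun z \o f) g_add).
have [|h hE] := @additive_factor _ _ _ (@cech_fun X) g (@cech_fun_inj X).
  move=> b; apply: cech_fun_surj; apply: locally_constant_comp; first exact: cts_fun.
  exact: cech_fun_locally_constant.
rewrite /cechH_map (@the_homP _ _ _ h) ?hE // => [U W p c|h' h'P y].
  by apply: cech_fun_inj; rewrite hE /= !cech_funE nerve_fun_map.
have [U [c ->]] := cechHP y; have [W [p]] := cover_map_preimage f U.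
by rewrite (h'P U W p); apply: cech_fun_inj; rewrite hE /= !cech_funE nerve_fun_map.
Qed.

End CechZero.

Section QuasiCohomologyZero.

Definition point_compact (X : topologicalType) (x : X) : compacts X :=
  Compacts (@compact_set1 X x).

Definition in_point (X : topologicalType) (x : X) : point_compact x :=
  exist _ x (mem_set erefl).

Definition quasi_fun_fun (X : topologicalType) (z : qcoH 0 X) : X -> int := fun x =>
  cech_fun (@lim_proj (qcoH_diagram 0 X) (point_compact x) z : cechH 0 (point_compact x))
    (in_point x).

Lemma quasi_fun_is_additive (X : topologicalType) : zmod_morphism (@quasi_fun_fun X).
Proof.
by move=> y z; apply/funext => x; rewrite /quasi_fun_fun !raddfB.
Qed.

HB.instance Definition _ (X : topologicalType) :=
  GRing.isZmodMorphism.Build _ _ _ (@quasi_fun_is_additive X).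

Definition quasi_fun (X : topologicalType) : {additive qcoH 0 X -> (X -> int)} := @quasi_fun_fun X.

#[global] Arguments quasi_fun {X}.

Lemma quasi_funE (X : topologicalType) (z : qcoH 0 X) (K : compacts X) (x : K) :
  cech_fun (@lim_proj (qcoH_diagram 0 X) K z : cechH 0 K) x = quasi_fun z (set_val x).
Proof.
have xK : point_compact (set_val x) `<=` K by move=> y ->; exact: set_valP.
have e : cechH_map 0 (incl2 xK) (@lim_proj (qcoH_diagram 0 X) K z) =
    @lim_proj (qcoH_diagram 0 X) (point_compact (set_val x)) z.
  by move/asboolP: (valP z) => /(_ K (point_compact (set_val x)) xK).
rewrite -[RHS]/(cech_fun (@lim_proj (qcoH_diagram 0 X) (point_compact (set_val x)) z
  : cechH 0 (point_compact (set_val x))) (in_point (set_val x))).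
rewrite -e cech_fun_map /=; congr (cech_fun _ _).
exact: val_inj.
Qed.

Lemma limit_ext (D : diagram) (x y : limit D) :
  (forall i, lim_proj i x = lim_proj i y) -> x = y.
Proof. by move=> xy; apply: val_inj; apply: functional_extensionality_dep. Qed.

Lemma quasi_fun_inj (X : topologicalType) : injective (@quasi_fun X).
Proof.
move=> y z yz; apply: limit_ext => K; apply: (@cech_fun_inj K).
by apply/funext => x; rewrite !quasi_funE yz.
Qed.

Definition compactly_locally_constant (X : topologicalType) (phi : X -> int) :=
  forall K : compacts X, locally_constant (phi \o set_val : K -> int).

Lemma quasi_fun_locally_constant (X : topologicalType) (z : qcoH 0 X) :
  compactly_locally_constant (quasi_fun z).
Proof.
move=> K; rewrite (_ : _ \o _ = cech_fun (@lim_proj (qcoH_diagram 0 X) K z : cechH 0 K)).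
  exact: cech_fun_locally_constant.
by apply/funext => x; rewrite quasi_funE.
Qed.

Lemma quasi_fun_surj (X : topologicalType) (phi : X -> int) :
  compactly_locally_constant phi -> exists z, quasi_fun z = phi.
Proof.
move=> phic.
pose x : zprod (fun K : compacts X => cechH 0 K) := fun K => sval (cid (cech_fun_surj (phic K))).
have xE K : cech_fun (x K) = phi \o set_val by exact: (svalP (cid (cech_fun_surj (phic K)))).
have xl : (x : zprod (@dgrp (qcoH_diagram 0 X))) \in lim_pred (D := qcoH_diagram 0 X).
  apply/asboolP => L K KL; apply: (@cech_fun_inj K).
  apply: etrans (cech_fun_map (incl2 KL) (x L)) _.
  exact: etrans (congr1 (fun h => h \o incl2 KL) (xE L)) (esym (xE K)).
exists (exist (fun b => b \in lim_pred (D := qcoH_diagram 0 X)) _ xl : limit (qcoH_diagram 0 X)).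
apply/funext => y.
exact: (congr1 (fun h => h (in_point y)) (xE (point_compact y))).
Qed.

(** The image of a compactum K is a compactum L with f(K) in L, so the
    characteristic property of the induced map can be tested on each K. *)
Lemma quasi_fun_map (X Y : topologicalType) (f : continuousType X Y) (z : qcoH 0 Y) :
  quasi_fun (qcoH_map 0 f z) = quasi_fun z \o f.
Proof.
have imc (K : compacts X) : compact (f @` K).
  by apply: continuous_compact; [apply: continuous_subspaceT; exact: cts_fun|exact: cpt_compact].
have g_add : zmod_morphism (fun z : qcoH 0 Y => quasi_fun z \o f).
  by move=> x y; rewrite raddfB.
pose g : {additive qcoH 0 Y -> (X -> int)} :=
  HB.pack (fun z : qcoH 0 Y => quasi_fun z \o f)
    (GRing.isZmodMorphism.Build _ _ (fun z : qcoH 0 Y => quasi_fun z \o f) g_add).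
have [|h hE] := @additive_factor _ _ _ (@quasi_fun X) g (@quasi_fun_inj X).
  move=> b; apply: quasi_fun_surj => K.
  have fK : f @` K `<=` Compacts (imc K) by [].
  have -> : (g b \o set_val : K -> int) = (quasi_fun b \o set_val) \o restr fK by [].
  apply: locally_constant_comp; first exact: restr_continuous.
  exact: quasi_fun_locally_constant.
rewrite /qcoH_map (@the_homP _ _ _ h) ?hE // => [K L fKL c|h' h'P y].
  apply: (@cech_fun_inj K); rewrite cech_fun_map; apply/funext => x.
  apply: etrans (quasi_funE (h c) x) _; rewrite hE.
  exact: esym (quasi_funE c (restr fKL x)).
apply: limit_ext => K; have fK : f @` K `<=` Compacts (imc K) by [].
rewrite (h'P _ _ fK); apply: (@cech_fun_inj K); apply/funext => x.
rewrite cech_fun_map; apply: etrans (quasi_funE y (restr fK x)) _.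
by apply/esym; apply: etrans (quasi_funE (h y) x) _; rewrite hE.
Qed.

End QuasiCohomologyZero.

(** * Pseudo-cohomology in degree 0 *)

Section PseudoCohomologyZero.
Context (R : realType).

(** A filter on the set which does not cluster at x contains the complement of a
    neighbourhood of x, hence a finite set. *)
Lemma compact_sequence (X : topologicalType) (x : X) (u : nat -> X) :
  u @ \oo --> x -> compact ([set x] `|` range u).
Proof.
move=> ux F FF FK; have [|ncl] := pselect (cluster F x).
  by move=> cl; exists x; split=> //; left.
have [A FA [B Bx AB]] : exists2 A, F A & exists2 B, nbhs x B & A `&` B = set0.
  apply: contrapT => nE; apply: ncl => A B FA xB.
  by apply/set0P/eqP => AB; apply: nE; exists A => //; exists B.
have [N _ NB] := ux _ Bx.
have AB0 y : A y -> ~ B y by move=> Ay By; have : (A `&` B) y by []; rewrite AB.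
have FS : F [set u n | n in `I_N].
  apply: (filterS _ (filterI FA FK)) => y [Ay [yx|[n _ ny]]].
    by case: (AB0 _ Ay); rewrite yx; exact: nbhs_singleton Bx.
  exists n => //=; rewrite ltnNge; apply/negP => /NB Bn.
  by case: (AB0 _ Ay); rewrite -ny.
have [|p [[n _ <-] cl]] := finite_compact _ FF FS.
  exact/finite_image/finite_II.
by exists (u n); split=> //; right; exists n.
Qed.

(** If phi is not locally constant at x, there are points converging to x at which
    phi differs from phi x; together with x they form a compactum on which phi is
    not locally constant. *)
Lemma compactly_locally_constantW (X : topologicalType) (phi : X -> int) :
  metrizable R X -> compactly_locally_constant phi -> locally_constant phi.
Proof.
move=> /metrizableP[d dn] phic x; apply: contrapT => nx.
have ex n : {y | d x y < n.+1%:R^-1 & phi y <> phi x}.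
  apply: cid2; apply: contrapT => nE; apply: nx; apply/dn.
  exists n.+1%:R^-1; first by rewrite invr_gt0.
  by move=> y /= xy; apply: contrapT => yx; apply: nE; exists y.
pose u n := s2val (ex n).
have ux : u @ \oo --> x.
  move=> A /dn[e e0 eA]; suff : \forall n \near \oo, A (u n) by [].
  near=> n; apply: eA => /=.
  have un : d x (u n) < n.+1%:R^-1 := s2valP (ex n).
  apply: lt_trans un _.
  by near: n; exact: near_infty_natSinv_lt (PosNum e0).
pose K := Compacts (compact_sequence ux).
have xK : x \in cpt_set K by rewrite inE; left.
have uK n : u n \in cpt_set K by rewrite inE; right; exists n.
have [B [[C oC <-] /= Cx CB]] := phic K (exist _ x xK).
have [N _ NC] : nbhs \oo (u @^-1` C) by apply: (ux C); exact: open_nbhs_nbhs.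
apply: (s2valP' (ex N)).
exact: (CB (exist _ (u N) (uK N)) (NC N (leqnn N))).
Unshelve. all: by end_near. Qed.

Context (X : topologicalType) (E : ANR_expansion R X).

Lemma quasi_fun_ANR (P : topologicalType) (z : qcoH 0 P) :
  ANR R P -> locally_constant (quasi_fun z).
Proof.
move=> [Pm _]; apply: compactly_locally_constantW => //.
exact: quasi_fun_locally_constant.
Qed.

Lemma tau_cohomologyE (l : ex_idx E) (x : qcoH 0 (ex_sp l)) :
  tau_cohomology 0 E (@colim_in (pcoH_diagram 0 E) l x) = qcoH_map 0 (ex_proj E l) x.
Proof.
have [|h hE] := @colim_desc (pcoH_diagram 0 E) _ (fun l => qcoH_map 0 (ex_proj E l)).
  move=> m k mk z; apply: quasi_fun_inj; apply/funext => y.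
  rewrite /= !quasi_fun_map /=.
  exact: (homotopic_locally_constant (ex_proj_bond mk) (quasi_fun_ANR z (ex_ANR m))).
rewrite /tau_cohomology (@the_homP _ _ _ h) ?hE // => h' h'P.
by apply: (@colim_ext (pcoH_diagram 0 E)) => k y; rewrite h'P hE.
Qed.

Lemma pcoHP (z : pcoH 0 E) : exists l (x : qcoH 0 (ex_sp l)),
  z = @colim_in (pcoH_diagram 0 E) l x.
Proof.
apply: (@colim_directed (pcoH_diagram 0 E)); first exact: ex_inhabited.
by move=> l m; have [n [ln mn]] := @ex_directed R X E l m; exists n.
Qed.

(** An element killed by the map comes from a locally constant function on some
    term whose pullback to X is 0. By (E2), applied to this function and to the
    constant 0, it becomes 0 on a further term. *)
Lemma tau_cohomology_inj : injective (tau_cohomology 0 E).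
Proof.
apply: raddf_inj => z; have [l [x ->]] := pcoHP z.
rewrite tau_cohomologyE => /(congr1 quasi_fun); rewrite quasi_fun_map raddf0 => x0.
have xc := quasi_fun_ANR x (ex_ANR l).
have [m [lm lm0]] : exists m (lm : (l <= m)%O),
    homotopic R (discrete_map xc \o ex_bond lm)
      (discrete_map (@locally_constant_cst (ex_sp l) _ 0) \o ex_bond lm).
  apply: ex_E2; first exact: discrete_ANR.
  by apply: homotopic_refl => y; exact: (congr1 (fun h => h y) x0).
rewrite -(@colim_inE (pcoH_diagram 0 E) l m lm).
suff -> : qcoH_map 0 (ex_bond lm) x = 0 by rewrite raddf0.
apply: quasi_fun_inj; rewrite quasi_fun_map raddf0; apply/funext => y.
exact: (homotopic_discrete lm0 y).
Qed.

(** As X is metrizable, the class is a locally constant function on X, and (E1) for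
    the discrete space int factors it through a term. *)
Lemma tau_cohomology_surj : metrizable R X ->
  forall y : qcoH 0 X, exists z, tau_cohomology 0 E z = y.
Proof.
move=> Xm y.
have yc : locally_constant (quasi_fun y).
  by apply: compactly_locally_constantW => //; exact: quasi_fun_locally_constant.
have [l [f yf]] := ex_E1 E (discrete_map yc) (discrete_ANR R _).
have [|x xf] := @quasi_fun_surj (ex_sp l) (f : ex_sp l -> int).
  move=> K; apply: locally_constant_comp (@discrete_map_locally_constant _ _ f).
  exact: set_val_continuous.
exists (@colim_in (pcoH_diagram 0 E) l x); rewrite tau_cohomologyE.
apply: quasi_fun_inj; rewrite quasi_fun_map xf; apply/funext => z.
exact: esym (homotopic_discrete yf z).
Qed.

End PseudoCohomologyZero.

Lemma inj_surj_bijective (A B : Type) (f : A -> B) :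
  injective f -> (forall y, exists x, f x = y) -> bijective f.
Proof.
move=> fi fs; have fK y : f (sval (cid (fs y))) = y by exact: (svalP (cid (fs y))).
by exists (fun y => sval (cid (fs y))) => // x; apply: fi.
Qed.

(** * Path components of ANRs are open *)

Section MetricSpace.
Context (R : realType).

(** A copy of T which remembers m, so that the topology of m can be attached to it
    whatever the topology of T is. *)
Definition metric_space (T : Type) (m : metric R T) : Type := T.

Section Instances.
Context (T : Type) (m : metric R T).
HB.instance Definition _ := gen_eqMixin (metric_space m).
HB.instance Definition _ := gen_choiceMixin (metric_space m).
HB.instance Definition _ := @isMetric.Build R (metric_space m) m
  (mt_distxx m) (@mt_dist_eq0 _ _ m) (mt_sym m) (fun y x z => mt_triangle m x y z).
End Instances.

Lemma metric_spaceP (T : Type) (m : metric R T) (x : metric_space m) (A : set (metric_space m)) :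
  nbhs x A <-> exists2 e : R, 0 < e & [set y | m x y < e] `<=` A.
Proof.
have : (mdist : metric_space m -> metric_space m -> R) = m by [].
rewrite -nbhs_ballE /nbhs_ball /nbhs_ball_ /filter_from => md.
by split=> [[e e0]|[e e0]]; rewrite ?ballEmdist /=; exists e => //=; rewrite ?ballEmdist.
Qed.

End MetricSpace.

(** Nearby points of an ANR P are joined by paths. Fix x. Attach to P an arc from
    each point y to x, all of it within distance d x y of x. In the resulting
    metric space P is closed, so it is a retract of a neighbourhood U. If y is close
    to x, the whole arc from y to x lies in U, and the retraction maps it to a path
    in P.

    The space is the product of P and [0, 1] with the closed set A of the pairs
    (y, t) such that y = x or t = 1 collapsed to the point (x, 0), and the
    distance of two points is the smaller of the distance in the product and of the
    sum of their distances to A. Below, [del] is the distance to A, [rho] the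
    metric, [base] the embedding of P, and [pt] and [ht] the two coordinates. *)
Section Arcs.
Context (R : realType) (P : topologicalType) (d : metric R P) (x : P).
Hypothesis dn : forall y (A : set P),
  nbhs y A <-> exists2 e : R, 0 < e & [set z | d y z < e] `<=` A.

Let d0 := mt_distxx d.
Let dge := mt_ge0 d.
Let dp := @mt_dist_eq0 _ _ d.
Let ds := mt_sym d.
Let dt := mt_triangle d.

(** The points outside A, and (x, 0) standing for A. *)
Definition arcs : set (P * R) :=
  [set w | [/\ w.1 <> x, 0 <= w.2 & w.2 < 1] \/ w = (x, 0)].

Let T := {w | w \in arcs}.
Let pt (w : T) : P := (val w).1.
Let ht (w : T) : R := (val w).2.
Let del (w : T) : R := Num.min (d x (pt w)) (1 - ht w).
Let rho (v w : T) : R := Num.min (d (pt v) (pt w) + `|ht v - ht w|) (del v + del w).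

Let ht_bound w : 0 <= ht w < 1.
Proof.
by rewrite /ht; case: w => -[y t] /= /set_mem [[/= _ -> ->]|[_ ->]] //; rewrite lexx ltr01.
Qed.

Let T_ext (v w : T) : pt v = pt w -> ht v = ht w -> v = w.
Proof.
move=> vw1 vw2; apply: val_inj.
by rewrite [val v]surjective_pairing [val w]surjective_pairing; congr pair.
Qed.

Let del_ge0 w : 0 <= del w.
Proof. by rewrite le_min dge; have := ht_bound w; lra. Qed.

Let del_eq0 w : del w = 0 -> pt w = x /\ ht w = 0.
Proof.
have := ht_bound w; rewrite /del minEle; case: ifP => [_ _ /dp|_ h h']; last by exfalso; lra.
by rewrite /pt /ht; case: w => -[y t] /= /set_mem [[/= yx _ _] /esym|[-> ->]].
Qed.

Let del_lip v w : del v <= del w + (d (pt v) (pt w) + `|ht v - ht w|).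
Proof.
rewrite /del; have := dt x (pt w) (pt v); rewrite (ds (pt w) (pt v)).
have := ler_norm (ht w - ht v); rewrite distrC.
have := normr_ge0 (ht v - ht w); have := dge (pt v) (pt w).
by rewrite /Num.min; case: ltP => ?; case: ltP => ?; lra.
Qed.

Let rhoxx w : rho w w = 0.
Proof. by rewrite /rho d0 subrr normr0 addr0 min_l // addr_ge0. Qed.

Let rho_eq0 v w : rho v w = 0 -> v = w.
Proof.
rewrite /rho minEle; case: ifP => _ h.
  have := dge (pt v) (pt w); have := normr_ge0 (ht v - ht w) => n0 dd.
  apply: T_ext; first by apply: dp; lra.
  by apply/eqP; rewrite -subr_eq0 -normr_eq0; apply/eqP; lra.
have := del_ge0 v; have := del_ge0 w => w0 v0.
have v0' : del v = 0 by lra.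
have w0' : del w = 0 by lra.
have [vx vt] := del_eq0 v0'; have [wx wt] := del_eq0 w0'.
by apply: T_ext; rewrite ?vx ?wx ?vt ?wt.
Qed.

Let rho_sym v w : rho v w = rho w v.
Proof. by rewrite /rho (ds (pt v)) distrC [del v + _]addrC. Qed.

Let rho_triangle v u w : rho v w <= rho v u + rho u w.
Proof.
have := del_lip v u; have := del_lip w u; rewrite (ds (pt w)) (distrC (ht w)).
have := del_ge0 u; have := del_ge0 v; have := del_ge0 w.
have := dt (pt v) (pt u) (pt w); have := ler_distD (ht u) (ht v) (ht w).
rewrite /rho; move: (del u) (del v) (del w) (d _ _) (d _ _) (d _ _) => a b c D1 D2 D3.
move: `|_ - _| `|_ - _| `|_ - _| => e1 e2 e3.
by rewrite /Num.min; do 3 (case: ltP => ?); lra.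
Qed.

Definition arc_metric : metric R T := Metric rhoxx rho_eq0 rho_sym rho_triangle.

Let M := metric_space arc_metric.

Let base_in y : (y, 0) \in arcs.
Proof.
rewrite inE; have [->|yx] := pselect (y = x); [by right|left].
by rewrite /= lexx ltr01.
Qed.

Let base (y : P) : M := exist _ (y, 0) (base_in y).

Let base_continuous : continuous base.
Proof.
move=> y A /metric_spaceP[e e0 eA]; apply/dn; exists e => // z yz; apply: eA.
by rewrite /= /rho gt_min /= /pt /ht /= subrr normr0 addr0 yz.
Qed.

(** At a point of height 0 the metric is at least as fine as d, provided that the
    radius is at most 1, the distance from P to the collapsed end t = 1; a point of
    positive height is at least as far from the image as the smaller of its height
    and its distance to A. *)
Let base_closed A : closed A -> closed (base @` A).
Proof.
move=> Ac; rewrite -[X in closed X]setCK closedC openE => w wA.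
apply/metric_spaceP.
have [t0|tN0] := eqVneq (ht w) 0.
  have wE : w = base (pt w) by apply: T_ext.
  have : nbhs (pt w) (~` A).
    apply: open_nbhs_nbhs; split; first by rewrite openC.
    by move=> Aw; apply: wA; exists (pt w).
  move=> /dn[e e0 eA]; exists (Num.min e 1); first by rewrite lt_min e0 ltr01.
  move=> v + [z Az zv]; rewrite -{}zv /= /rho gt_min !lt_min => wz.
  suff : d (pt w) z < e by move=> /eA; apply.
  have zE : pt (base z) = z by [].
  have hE : ht (base z) = 0 by [].
  move: wz; rewrite /del zE hE t0 !subr0; case/orP => /andP[].
    by move=> ce _; apply: le_lt_trans ce; rewrite lerDl.
  have := dt (pt w) x z; rewrite (ds _ x); have := dge x (pt w); have := dge x z.
  by rewrite /Num.min; case: (ltP (d x (pt w)) 1) => ?; case: (ltP (d x z) 1) => ?; lra.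
have w0 : 0 < del w.
  rewrite lt_neqAle del_ge0 andbT eq_sym; apply/eqP => /del_eq0[_ h].
  by rewrite h eqxx in tN0.
have t0 : 0 < ht w by case/andP: (ht_bound w) => h _; rewrite lt_def h andbT.
exists (Num.min (ht w) (del w)); first by rewrite lt_min t0 w0.
move=> v + [z Az zv]; rewrite -{}zv /= /rho.
have := del_ge0 (base z); have := dge (pt w) (pt (base z)).
have -> : `|ht w - ht (base z)| = ht w by rewrite /ht subr0 ger0_norm // ltW.
move: w0; move: (del w) (del (base z)) => a b ? ? ?.
by rewrite gt_min !lt_min => /orP[] /andP[]; lra.
Qed.

Let base_embedding : closed_embedding base.
Proof.
split; [exact: base_continuous| |exact: base_closed].
by move=> y z /(congr1 (fun w : M => pt w)).
Qed.

(** The arc from y to x, extended to all real times by constants: at time 1 it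
    reaches A, which is the point (x, 0). *)
Let arc_fun (y : P) (t : R) : P * R := if t < 1 then (y, Num.max 0 t) else (x, 0).

Let arc_in y t : y <> x -> arc_fun y t \in arcs.
Proof.
move=> yx; rewrite inE /arc_fun; case: ltP => t1; last by right.
by left; split => //=; rewrite ?le_max ?lexx // gt_max ltr01.
Qed.

Let arc y (yx : y <> x) (t : R) : M := exist _ (arc_fun y t) (arc_in t yx).

Let arc_lip y (yx : y <> x) s t : rho (arc yx s) (arc yx t) <= `|s - t|.
Proof.
wlog st : s t / s <= t.
  by move=> H; have [/H//|/ltW/H] := leP s t; rewrite rho_sym distrC.
rewrite distrC ger0_norm ?subr_ge0 //.
rewrite /rho /del /pt /ht /= /arc_fun; clear yx.
case: (ltP t 1) => t1; case: (ltP s 1) => s1 //=; try (exfalso; lra).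
- rewrite ge_min d0 add0r distrC ger0_norm; first last.
    by rewrite subr_ge0; rewrite /Num.max; do 2(case: ltP => ?); lra.
  apply/orP; left; rewrite /Num.max; do 2(case: ltP => ?); lra.
- rewrite ge_min d0 !subr0 [Num.min 0 1]min_l ?ler01 // addr0; apply/orP; right.
  rewrite ge_min; apply/orP; right; rewrite /Num.max; case: ltP => ?; lra.
- by rewrite d0 subrr normr0 addr0 ge_min subr_ge0 st.
Qed.

Let arc_continuous y (yx : y <> x) : continuous (arc yx).
Proof.
move=> t A /metric_spaceP[e e0 eA].
have : nbhs t (ball t e) by exact: nbhsx_ballx.
by apply: filterS => s ts; apply: eA; exact: le_lt_trans (arc_lip yx t s) ts.
Qed.

Lemma arc_path_nbhs : ANR R P ->
  \forall y \near x, exists g : R -> P, [/\ continuous g, g 0 = y & g 1 = x].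
Proof.
move=> [_ /(_ M base (metric_metrizable _) base_embedding)[U [Uo baseU [r rU]]]].
have [|e e0 eU] := (metric_spaceP (base x) U).1.
  by apply: open_nbhs_nbhs; split=> //; apply: baseU; exists x.
apply/dn; exists e => // y /= xy.
have [->|yx] := pselect (y = x); first by exists (cst x); split=> // ?; exact: cvg_cst.
have arcU t : arc yx t \in U.
  rewrite inE; apply: eU => /=; apply: le_lt_trans xy.
  rewrite /rho ge_min; apply/orP; right.
  rewrite {1}/del /pt /ht /= d0 subr0 min_l ?ler01 // add0r /del /pt /ht /= /arc_fun.
  by rewrite ge_min; case: ifP => _ /=; rewrite ?lexx ?d0 ?dge.
exists (fun t => r (exist _ (arc yx t) (arcU t) : U)); split.
- move=> t; apply: (@continuous_comp _ _ _ (fun t => exist _ (arc yx t) (arcU t) : U) r).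
    by apply: continuous_comp_initial => s; exact: arc_continuous.
  exact: cts_fun.
- apply: rU; apply: T_ext; rewrite /pt /ht /= /arc_fun ltr01 //=.
  by rewrite max_l.
- by apply: rU; apply: T_ext; rewrite /pt /ht /= /arc_fun ltxx.
Qed.

End Arcs.

Lemma ANR_path_nbhs (R : realType) (P : topologicalType) (x : P) : ANR R P ->
  \forall y \near x, exists g : R -> P, [/\ continuous g, g 0 = y & g 1 = x].
Proof.
move=> PA; have [/metrizableP[d dn] _] := PA.
exact: (arc_path_nbhs x dn PA).
Qed.

(** * Singular homology in degree 0 *)

Section SingularZero.
Context (R : realType).

Lemma simplex0_unique (u v : @simplex R 0) : u = v.
Proof.
apply: val_inj; apply/matrixP => i j; rewrite !ord1.
have [_ /=] := set_valP u; have [_ /=] := set_valP v.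
by rewrite !big_ord_recl !big_ord0 !addr0 => <- <-.
Qed.

Lemma const1_simplex0 : (const_mx 1 : 'rV[R]_1) \in @simplex R 0.
Proof.
rewrite inE; split=> [i|]; first by rewrite mxE ler01.
by rewrite big_ord_recl big_ord0 addr0 mxE.
Qed.

Definition point_simplex : @simplex R 0 := exist (fun v => v \in @simplex R 0) _ const1_simplex0.

Section Classes.
Context (P : topologicalType).

Definition point_chain (q : P) : chain R P 0 := << (cst q : continuousType (@simplex R 0) P) >>.

Definition cycle_of_chain (c : chain R P 0) : zcycle (bd R P 0) :=
  exist (fun c => c \in zker (bd R P 0)) c (eqxx 0).

Lemma cycle_of_chain_is_additive : zmod_morphism cycle_of_chain.
Proof. by move=> c c'; apply: val_inj. Qed.

HB.instance Definition _ :=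
  GRing.isZmodMorphism.Build _ _ cycle_of_chain cycle_of_chain_is_additive.

Definition class_of_chain : {additive chain R P 0 -> singH R P 0} :=
  zquot_pi _ \o cycle_of_chain.

Definition point_class (q : P) : singH R P 0 := class_of_chain (point_chain q).

Lemma singH0_surj (h : singH R P 0) : exists c, h = class_of_chain c.
Proof.
have [z ->] := zquot_surj h; exists (val z); congr zquot_pi; exact: val_inj.
Qed.

Lemma simplex0E (s : continuousType (@simplex R 0) P) : s = cst (s point_simplex).
Proof. by apply/continuousEP => u; congr (s _); exact: simplex0_unique. Qed.

(** A singular 0-simplex is a point, so H_0 is generated by the classes of points. *)
Lemma singH0_ind (S : set (singH R P 0)) :
  S 0 -> (forall h h', S h -> S h' -> S (h - h')) -> (forall q, S (point_class q)) ->
  forall h, S h.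
Proof.
move=> S0 SB Sq h; have [c ->] := singH0_surj h.
have SN g : S g -> S (- g) by move=> Sg; rewrite -sub0r; exact: SB.
have SD g g' : S g -> S g' -> S (g + g').
  by move=> Sg Sg'; rewrite -[g']opprK; apply/SB/SN.
have Sn g n : S g -> S (g *+ n).
  by move=> Sg; elim: n => [|n IH]; rewrite ?mulr0n // mulrS; exact: SD.
rewrite -(freeg_sumE c) raddf_sum; apply: (big_ind S) => // s _.
move: (coeff _ _) => m; rewrite -[m]intz -freegU_mulz raddfMz (simplex0E s).
have := Sq (s point_simplex); rewrite /point_class /point_chain.
by case: m => n Ss; [exact: Sn|rewrite NegzE mulrNz; exact/SN/Sn].
Qed.

Lemma singH0_ext (G : zmodType) (f g : {additive singH R P 0 -> G}) :
  (forall q, f (point_class q) = g (point_class q)) -> f =1 g.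
Proof.
move=> fg; apply: (@singH0_ind [set h | f h = g h]) => //=; first by rewrite !raddf0.
by move=> h h' fh fh'; rewrite !raddfB fh fh'.
Qed.

Let last_coord (v : 'rV[R]_2) : R := v 0 ord_max.

Let last_coord_continuous : continuous last_coord.
Proof. exact: coord_continuous. Qed.

HB.instance Definition _ := isContinuous.Build _ _ last_coord last_coord_continuous.

Let last_coord_simplex : last_coord @` @simplex R 1 `<=` `[0, 1]%classic.
Proof.
move=> _ [v [v0 v1] <-]; rewrite /= in_itv /= v0 /= -v1.
by rewrite !big_ord_recr big_ord0 /= add0r lerDr v0.
Qed.

(** A path, parametrized by the last barycentric coordinate of the 1-simplex. *)
Section Edge.
Context (g : R -> P).
Hypothesis gc : {within `[0, 1], continuous g}.

Let edge_fun : @simplex R 1 -> P := fun u => g (last_coord (set_val u)).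

Let edge_continuous : continuous edge_fun.
Proof.
have -> : edge_fun = sigL `[0, 1]%classic g \o restr last_coord_simplex by [].
move=> u; apply: continuous_comp; first exact: cts_fun.
by move/subspace_sigL_continuousP: gc; exact.
Qed.

HB.instance Definition _ := isContinuous.Build _ _ edge_fun edge_continuous.

Lemma point_class_path : point_class (g 0) = point_class (g 1).
Proof.
apply/eqP; rewrite eq_sym -subr_eq0 -raddfB /class_of_chain /=.
rewrite -(raddf0 (zquot_pi _)) zquot_pi_eq subr0; apply: Defs.sub_span.
exists << (edge_fun : continuousType (@simplex R 1) P) >> => //=.
rewrite liftU scale1r /bd_simplex !big_ord_recl big_ord0 /=.
rewrite expr0 scale1r /bump /= expr1 scaleN1r addr0.
congr (_ - _); congr (<< _ >>); apply/continuousEP => u /=; rewrite /edge_fun /last_coord /=.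
  rewrite mxE; case: unliftP => [j|//] jE.
  rewrite (ord1 j); have [_ /=] := set_valP u.
  by rewrite big_ord_recl big_ord0 addr0 => ->.
have -> : ord_max = fintype.lift ord0 ord0 :> 'I_2 by apply: val_inj.
by rewrite mxE unlift_none.
Qed.

End Edge.

Lemma point_class_locally_constant : ANR R P -> locally_constant point_class.
Proof.
move=> PA x; near=> y.
have [g [gc <- <-]] : exists g : R -> P, [/\ continuous g, g 0 = y & g 1 = x].
  by near: y; exact: ANR_path_nbhs.
by apply: point_class_path; exact: continuous_subspaceT.
Unshelve. all: by end_near. Qed.

Let segment_point (t : R) : 'rV[R]_2 := \row_j if j == ord0 then 1 - t else t.

Let segment_point_continuous : continuous segment_point.
Proof.
move=> t A [Q Qt QA]; rewrite nbhs_simpl /=.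
have Q0 := Qt 0 ord0; have Q1 := Qt 0 ord_max; rewrite !mxE /= in Q0 Q1.
have c0 : (fun s : R => 1 - s) @ t --> 1 - t.
  by apply: cvgB; [exact: cvg_cst|exact: cvg_id].
have n0 : nbhs t [set s | Q 0 ord0 (1 - s)] by exact: c0 Q0.
suff : nbhs t (segment_point @^-1` A) by [].
near=> s; have Qs0 : Q 0 ord0 (1 - s) by near: s.
have Qs1 : Q 0 ord_max s by near: s.
apply: QA => i j; rewrite (ord1 i) mxE; case: ifP => [/eqP->//|j0].
suff -> : j = ord_max by [].
by apply: val_inj; case: j j0 => -[|[|]].
Unshelve. all: by end_near. Qed.

Let segment_point_simplex (t : `[0, 1]%classic) : segment_point (set_val t) \in @simplex R 1.
Proof.
have := set_valP t; rewrite /= in_itv /= => /andP[t0 t1].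
rewrite inE; split=> [i|]; first by rewrite mxE; case: ifP; rewrite ?subr_ge0.
by rewrite !big_ord_recl big_ord0 !mxE /= addr0 subrK.
Qed.

(** The two ends of a singular 1-simplex are joined by a path, so a locally constant
    function takes the same value at both, and its additive extension to 0-chains
    vanishes on boundaries. *)
Lemma pairing_ex (G : zmodType) (phi : P -> G) : locally_constant phi ->
  exists h : {additive singH R P 0 -> G}, forall q, h (point_class q) = phi q.
Proof.
move=> phic.
pose f0 (s : continuousType (@simplex R 0) P) : zmodule G := phi (s point_simplex).
pose f : {additive chain R P 0 -> zmodule G} := fglift f0.
have fE s : f << s >> = f0 s by rewrite /f /= liftU scale1r.
pose fz_fun (z : zcycle (bd R P 0)) : zmodule G := f (val z).
have fz_add : zmod_morphism fz_fun by move=> z z'; rewrite /fz_fun raddfB.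
pose fz : {additive zcycle (bd R P 0) -> zmodule G} :=
  HB.pack fz_fun (GRing.isZmodMorphism.Build _ _ fz_fun fz_add).
have fb (z : zcycle (bd R P 0)) : range (bd R P 1) (val z) -> fz z = 0.
  case=> b _ bz; rewrite /fz /= /fz_fun -bz {bz}; move: b.
  apply: (@freeg_additive_ext _ _ (f \o bd R P 1) \0) => s /=.
  rewrite liftU scale1r /bd_simplex !big_ord_recl big_ord0 /=.
  rewrite expr0 scale1r /bump /= expr1 scaleN1r addr0 raddfB !fE /f0 /=.
  pose seg (t : `[0, 1]%classic) : @simplex R 1 :=
    exist (fun v => v \in @simplex R 1) _ (segment_point_simplex t).
  have segc : continuous seg.
    apply: continuous_comp_initial => t.
    apply: (@continuous_comp _ _ _ set_val segment_point); first exact: set_val_continuous.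
    exact: segment_point_continuous.
  (* A path is a function on the whole real line; outside [0, 1] the value y0 is
     arbitrary. *)
  pose y0 := s (@face R 0 ord0 point_simplex).
  have gc : {within `[0, 1], continuous (valL_ y0 (s \o seg))}.
    apply/subspace_valL_continuousP' => t.
    by apply: continuous_comp; [exact: segc|exact: cts_fun].
  have in01 (t : R) : 0 <= t <= 1 -> t \in `[0, 1]%classic by rewrite inE /= in_itv.
  have gE (t : R) (t01 : 0 <= t <= 1) : valL_ y0 (s \o seg) t = s (seg (exist _ t (in01 t t01))).
    exact: (congr1 (fun h => h (exist _ t (in01 t t01))) (valLK y0 (s \o seg))).
  have l01 (t : R) : t = 0 \/ t = 1 -> 0 <= t <= 1.
    by case=> ->; rewrite lexx ?ler01.
  have l0 := l01 _ (or_introl erefl); have l1 := l01 _ (or_intror erefl).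
  have e := locally_constant_path gc phic; rewrite (gE 0 l0) (gE 1 l1) /= in e.
  rewrite -[LHS]/(phi (s (@face R 0 ord0 point_simplex)) -
    phi (s (@face R 0 (fintype.lift ord0 ord0) point_simplex))).
  have -> : @face R 0 ord0 point_simplex = seg (exist _ 1 (in01 1 l1)).
    apply: val_inj; apply/matrixP => i j; rewrite !mxE /=.
    case: unliftP => [k|] ->; first by rewrite mxE.
    by rewrite eqxx subrr.
  have -> : @face R 0 (fintype.lift ord0 ord0) point_simplex = seg (exist _ 0 (in01 0 l0)).
    apply: val_inj; apply/matrixP => i j; rewrite !mxE.
    by case: unliftP => [k|] -> //; rewrite (ord1 k) mxE /= subr0.
  by rewrite e subrr.
exists (zquot_lift fb : {additive zquot _ -> zmodule G}) => q.
by apply: etrans (zquot_liftE fb _) _; rewrite /fz /= /fz_fun /= fE.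
Qed.

End Classes.
End SingularZero.

(** * Pairing H_0 with locally constant functions *)

Definition pairing (R : realType) (P : topologicalType) (G : zmodType) (phi : P -> G)
    (phic : locally_constant phi) : {additive singH R P 0 -> G} :=
  sval (cid (pairing_ex R phic)).

#[global] Arguments pairing {R P G phi} phic.

Section Pairing.
Context (R : realType).

Lemma singH_map_point (P Q : topologicalType) (f : continuousType P Q) (q : P) :
  singH_map R f 0 (point_class R q) = point_class R (f q).
Proof.
apply: etrans (zquot_liftE _ _) _; rewrite /point_class /class_of_chain /=.
congr zquot_pi; apply: val_inj => /=; rewrite /point_chain liftU scale1r /push_simplex.
by congr (<< _ >>); apply/continuousEP.
Qed.

Lemma pairingE (P : topologicalType) (G : zmodType) (phi : P -> G)
    (phic : locally_constant phi) q : pairing phic (point_class R q) = phi q.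
Proof. exact: (svalP (cid (pairing_ex R phic))). Qed.

Lemma eq_pairing (P : topologicalType) (G : zmodType) (phi psi : P -> G)
    (phic : locally_constant phi) (psic : locally_constant psi) :
  phi =1 psi -> pairing (R := R) phic =1 pairing psic.
Proof. by move=> e; apply: singH0_ext => q; rewrite !pairingE. Qed.

Lemma pairing_map (P Q : topologicalType) (f : continuousType P Q) (G : zmodType)
    (phi : Q -> G) (phic : locally_constant phi) (phifc : locally_constant (phi \o f))
    (h : singH R P 0) :
  pairing phic (singH_map R f 0 h) = pairing phifc h.
Proof.
apply: (@singH0_ext R P _ (pairing phic \o singH_map R f 0)) => q.
rewrite -[LHS]/(pairing phic (singH_map R f 0 (point_class R q))).
by rewrite singH_map_point !pairingE.
Qed.

Lemma pairing_additive (P : topologicalType) (G H : zmodType) (u : {additive G -> H})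
    (phi : P -> G) (phic : locally_constant phi) (uphic : locally_constant (u \o phi))
    (h : singH R P 0) :
  pairing uphic h = u (pairing phic h).
Proof.
by apply: (@singH0_ext R P _ _ (u \o pairing phic)) => q; rewrite /= !pairingE.
Qed.

Lemma pairingD (P : topologicalType) (G : zmodType) (phi psi chi : P -> G)
    (phic : locally_constant phi) (psic : locally_constant psi) (chic : locally_constant chi)
    (h : singH R P 0) :
  (forall q, chi q = phi q + psi q) -> pairing chic h = pairing phic h + pairing psic h.
Proof.
move=> chiE; apply: (@singH0_ext R P _ _ (pairing phic \+ pairing psic)) => q.
by rewrite /= !pairingE.
Qed.

Section Separation.
Context (P : topologicalType) (PA : ANR R P).

(** The point classes distinguish the path components of P, so these are the
    indicator functions of the path components (and 0, if g is not the class of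
    a point). *)
Definition class_indicator (g : singH R P 0) (q : P) : int := (point_class R q == g)%:R.

Lemma class_indicator_locally_constant g : locally_constant (class_indicator g).
Proof.
exact: (locally_constant_map (fun h => (h == g)%:R) (point_class_locally_constant PA)).
Qed.

Lemma sum_class_indicator (s : seq (singH R P 0)) q : uniq s -> point_class R q \in s ->
  \sum_(g <- s) g *~ class_indicator g q = point_class R q.
Proof.
move=> us qs; rewrite (bigD1_seq (point_class R q)) //= {1}/class_indicator eqxx mulr1z.
by rewrite big1 ?addr0 // => g gq; rewrite /class_indicator eq_sym (negPf gq) mulr0z.
Qed.

(** A class is recovered from its pairings with the indicators of finitely many
    components. Allowing every larger list s makes the property stable under
    differences. *)
Lemma singH0_expand (h : singH R P 0) :
  exists s0 : seq (singH R P 0), forall s, uniq s -> {subset s0 <= s} ->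
    h = \sum_(g <- s) g *~ pairing (@class_indicator_locally_constant g) h.
Proof.
move: h; apply: (@singH0_ind R P [set h | exists s0 : seq (singH R P 0), forall s,
  uniq s -> {subset s0 <= s} ->
    h = \sum_(g <- s) g *~ pairing (@class_indicator_locally_constant g) h]) => /=.
- by exists [::] => s _ _; rewrite big1 // => g _; rewrite raddf0 mulr0z.
- move=> h h' [s0 hs] [s0' hs']; exists (s0 ++ s0') => s us ss.
  under eq_bigr do rewrite raddfB mulrzBr.
  by rewrite sumrB -hs -?hs' // => g gs; apply: ss; rewrite mem_cat gs ?orbT.
- move=> q; exists [:: point_class R q] => s us ss.
  under eq_bigr do rewrite pairingE.
  by rewrite sum_class_indicator //; apply: ss; rewrite mem_head.
Qed.

Lemma singH0_separation (h h' : singH R P 0) :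
  (forall (phi : P -> int) (phic : locally_constant phi), pairing phic h = pairing phic h') ->
  h = h'.
Proof.
move=> hh'; have [s hs] := singH0_expand h; have [s' hs'] := singH0_expand h'.
have ss : {subset s <= undup (s ++ s')} by move=> g gs; rewrite mem_undup mem_cat gs.
have ss' : {subset s' <= undup (s ++ s')} by move=> g gs; rewrite mem_undup mem_cat gs orbT.
rewrite (hs _ (undup_uniq _) ss) (hs' _ (undup_uniq _) ss').
by apply: eq_bigr => g _; rewrite hh'.
Qed.

End Separation.

End Pairing.

(** * The values of a quasi-homology class on locally constant functions *)

Section Evaluation.
Context (R : realType) (X : topologicalType) (E : ANR_expansion R X) (y : qH 0 E).

Let term (l : ex_idx E) : singH R (ex_sp l) 0 := @lim_proj (qH_diagram 0 E) l y.

Lemma term_bond l m (lm : (l <= m)%O) : singH_map R (ex_bond lm) 0 (term m) = term l.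
Proof. by move/asboolP: (valP y) => /(_ m l lm). Qed.

(** The value of y at phi, computed on a term of the expansion through which phi
    factors. By (E2) it does not depend on the factorization
    ([evaluation_spec_uniq]), and by (E1) there is one if phi is locally constant
    ([evaluation_factor]). *)
Definition evaluation_spec (G : zmodType) (phi : X -> G) (v : G) :=
  exists l (f : ex_sp l -> G) (fc : locally_constant f),
    phi =1 f \o ex_proj E l /\ v = pairing fc (term l).

Lemma evaluation_specS (G : zmodType) (phi : X -> G) l (f : ex_sp l -> G)
    (fc : locally_constant f) m (lm : (l <= m)%O) : phi =1 f \o ex_proj E l ->
  exists (g : ex_sp m -> G) (gc : locally_constant g),
    phi =1 g \o ex_proj E m /\ pairing fc (term l) = pairing gc (term m).
Proof.
move=> phif; exists (f \o ex_bond lm).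
exists (locally_constant_comp (cts_fun (s := ex_bond lm)) fc); split.
  move=> x; rewrite phif.
  exact: esym (homotopic_locally_constant (ex_proj_bond lm) fc x).
by rewrite -(term_bond lm); exact: pairing_map.
Qed.

Lemma evaluation_spec_uniq (G : zmodType) (phi : X -> G) v w :
  evaluation_spec phi v -> evaluation_spec phi w -> v = w.
Proof.
move=> [l [f [fc [phif ->]]]] [m [g [gc [phig ->]]]].
have [n [ln mn]] := ex_directed l m.
have [f' [f'c [phif' ->]]] := evaluation_specS fc ln phif.
have [g' [g'c [phig' ->]]] := evaluation_specS gc mn phig.
have [|k [nk nkE]] := @ex_E2 R X E _ n (discrete_map f'c) (discrete_map g'c) (discrete_ANR R _).
  by apply: homotopic_refl => x; exact: etrans (esym (phif' x)) (phig' x).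
rewrite -(term_bond nk).
have c1 := locally_constant_comp (cts_fun (s := ex_bond nk)) f'c.
have c2 := locally_constant_comp (cts_fun (s := ex_bond nk)) g'c.
rewrite (pairing_map f'c c1) (pairing_map g'c c2).
by apply: eq_pairing => q; exact: (homotopic_discrete nkE q).
Qed.

Definition evaluation (G : zmodType) (phi : X -> G) : G := xget 0 (evaluation_spec phi).

Lemma evaluationP (G : zmodType) (phi : X -> G) v : evaluation_spec phi v -> evaluation phi = v.
Proof.
by move=> phiv; apply: (evaluation_spec_uniq _ phiv); apply: xgetPex; exists v.
Qed.

Lemma evaluationE (G : zmodType) l (f : ex_sp l -> G) (fc : locally_constant f) :
  evaluation (f \o ex_proj E l) = pairing fc (term l).
Proof. by apply: evaluationP; exists l, f, fc. Qed.

Lemma evaluation_factor (G : zmodType) (phi : X -> G) : locally_constant phi ->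
  exists l (f : ex_sp l -> G), locally_constant f /\ phi =1 f \o ex_proj E l.
Proof.
move=> phic; have [l [f phif]] := ex_E1 E (discrete_map phic) (discrete_ANR R _).
exists l, (f : ex_sp l -> G); split; first exact: discrete_map_locally_constant.
exact: homotopic_discrete phif.
Qed.

Lemma evaluation_additive (G H : zmodType) (u : {additive G -> H}) (phi : X -> G) :
  locally_constant phi -> evaluation (u \o phi) = u (evaluation phi).
Proof.
move=> /evaluation_factor[l [f [fc /funext ->]]]; rewrite evaluationE.
have ufc := locally_constant_map u fc.
by rewrite -(pairing_additive fc ufc) -evaluationE.
Qed.

Lemma evaluationD (G : zmodType) (phi psi : X -> G) :
  locally_constant phi -> locally_constant psi ->
  evaluation (phi \+ psi) = evaluation phi + evaluation psi.
Proof.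
move=> /evaluation_factor[l [f [fc phif]]] /evaluation_factor[m [g [gc psig]]].
have [n [ln mn]] := ex_directed l m.
have [f' [f'c [/funext-> _]]] := evaluation_specS fc ln phif.
have [g' [g'c [/funext-> _]]] := evaluation_specS gc mn psig.
have hc := locally_constant_map2 +%R f'c g'c.
rewrite -[_ \+ _]/((fun q => f' q + g' q) \o ex_proj E n) !evaluationE.
exact: pairingD.
Qed.

End Evaluation.

(** * Compact supports *)

Section Compactness.
Context (R : realType).

Lemma compact_setT_sub (X : topologicalType) (K : set X) :
  compact K -> compact [set: K].
Proof.
move=> Kc F FF _.
have FK : F (set_val @^-1` K).
  by apply: (@filterS _ F _ setT) => [x _|]; [exact: set_valP|exact: filterT].
have [p [Kp pF]] := Kc _ (fmap_proper_filter set_val FF) FK.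
exists (exist _ p (mem_set Kp)); split=> // A B FA [_ [[C oC <-] /= Cp CB]].
have FiA : F (set_val @^-1` (set_val @` A)).
  by apply: (@filterS _ F _ A) => // x Ax; exists x.
have [_ [[x Ax <-] Cx]] := pF _ _ FiA (open_nbhs_nbhs (conj oC Cp)).
by exists x; split => //; exact: CB.
Qed.

(** For K empty the empty list works; otherwise a point of K turns it into a
    pointed space, to which the covering characterization of compactness applies. *)
Lemma compact_finite_cover (K : topologicalType) (I : choiceType) (D : set I) (U : I -> set K) :
  compact [set: K] -> (forall i, D i -> open (U i)) -> (forall x, exists2 i, D i & U i x) ->
  exists s : seq I, (forall i, i \in s -> D i) /\ forall x, exists2 i, i \in s & U i x.
Proof.
have [K0|] := pselect ([set: K] = set0).
  by exists [::]; split=> // x; have : [set: K] x by []; rewrite K0.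
move=> /eqP/set0P[x0 _].
pose Kp : ptopologicalType := HB.pack (Topological.sort K)
  (isPointed.Build (Topological.sort K) x0) (Topological.class K).
have -> : @compact K = @compact Kp by [].
rewrite compact_cover => Kc Uo Uc.
have [|s sD sU] := Kc I D U Uo; first by move=> x _; have [i Di ix] := Uc x; exists i.
exists (finmap.enum_fset s); split; first by move=> i /sD; rewrite inE.
by move=> x; have [i /= si ix] := sU x Logic.I; exists i.
Qed.

Definition countable_base (X : topologicalType) (B : nat -> set X) :=
  (forall n, open (B n)) /\ forall (x : X) A, nbhs x A -> exists n, B n x /\ B n `<=` A.

(** The balls of radius 1 / (m + 1) around the points of a countable dense set,
    indexed by the codes of pairs (number of the centre, m). *)
Lemma separable_countable_base (X : topologicalType) :
  metrizable R X -> separable X -> exists B : nat -> set X, countable_base B.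
Proof.
move=> /metrizableP[d dn] [D /countable_injP[c cD] Dd].
have d0 := mt_distxx d; have ds := mt_sym d; have dt := mt_triangle d.
pose ball (x : X) (m : nat) := [set y | d x y < m.+1%:R^-1].
have ball_open x m : open (ball x m).
  rewrite openE => y xy; apply/dn; exists (m.+1%:R^-1 - d x y); first by rewrite subr_gt0.
  by move=> z /=; rewrite /ball /= ltrBrDl; exact: le_lt_trans (dt x y z).
pose B n := if (unpickle n : option (nat * nat)) is Some (i, m)
  then \bigcup_(x in [set x | D x /\ c x = i]) ball x m else set0.
exists B; split=> [n|x A /dn[e e0 eA]].
  by rewrite /B; case: unpickle => [[i m]|]; [exact: bigcup_open|exact: open0].
have [m me] : exists m : nat, m.+1%:R^-1 < e / 2.
  have [m _ mP] := near_infty_natSinv_lt (PosNum (divr_gt0 e0 (ltr0n R 2))).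
  by exists m; exact: (mP m (leqnn m)).
have [p [xp Dp]] : ball x m `&` D !=set0.
  by apply: Dd => //; exists x; rewrite /ball /= d0 invr_gt0.
exists (pickle (c p, m)); rewrite /B pickleK; split.
  by exists p => //; rewrite /ball /= ds.
move=> z [q [Dq /cD qp]]; rewrite qp ?inE // /ball /= => pz; apply: eA => /=.
by move: me pz xp (dt x p z); rewrite /ball /=; move: (m.+1%:R^-1) => i; lra.
Qed.

(** For each basic open set take a compactum containing it, if there is one; local
    compactness says that the interiors of these compacta cover X. *)
Lemma local_compactum_exhaustion (X : topologicalType) : local_compactum R X ->
  exists C : nat -> set X, (forall n, compact (C n)) /\ forall x : X, exists n, nbhs x (C n).
Proof.
move=> [lc Xs Xm]; have [B [Bo Bb]] := separable_countable_base Xm Xs.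
have ch n : {C | compact C & (exists2 A, compact A & B n `<=` A) -> B n `<=` C}.
  apply: cid2; have [[A Ac BA]|nA] := pselect (exists2 A, compact A & B n `<=` A).
    by exists A.
  by exists set0 => // ; exact: compact0.
exists (fun n => s2val (ch n)); split; first by move=> n; exact: (s2valP (ch n)).
move=> x; have [A xA [Ac _]] := lc x Logic.I.
have [|n [Bx BA]] := Bb x A; first by move: xA; rewrite withinE => -[V xV]; rewrite !setIT => ->.
exists n; apply: filterS (open_nbhs_nbhs (conj (Bo n) Bx)).
by apply: (s2valP' (ch n)); exists A.
Qed.

(** Suppose that for each i some phi_i vanishes on the union of the C n with n < i
    but has a nonzero value. Near any point almost all phi_i vanish, so they are
    the coefficients of one locally constant function with values in {poly int}.
    By naturality its value has the values of the phi_i, all of them nonzero, as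
    its coefficients. *)
Lemma evaluation_compact_support (X : topologicalType) (E : ANR_expansion R X) (y : qH 0 E) :
  local_compactum R X ->
  exists K : compacts X, forall phi : X -> int, locally_constant phi ->
    (forall x, cpt_set K x -> phi x = 0) -> evaluation y phi = 0.
Proof.
move=> /local_compactum_exhaustion[C [Cc CX]].
have Kc i : compact (\big[setU/set0]_(n < i) C n).
  elim: i => [|i IH]; first by rewrite big_ord0; exact: compact0.
  by rewrite big_ord_recr; exact: compactU.
apply: contrapT => nK.
have ex i : {phi : X -> int | locally_constant phi /\
    (forall x n, (n < i)%N -> C n x -> phi x = 0) & evaluation y phi <> 0}.
  apply: cid2; apply: contrapT => nE; apply: nK; exists (Compacts (Kc i)) => phi phic phi0.
  apply: contrapT => phin; apply: nE; exists phi => //; split=> // x n ni Cx.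
  by apply: phi0 => /=; rewrite -bigcup_mkord; exists n.
pose phi i := s2val (ex i).
have phic i : locally_constant (phi i) by have [] := s2valP (ex i).
have phi0 i x n : (n < i)%N -> C n x -> phi i x = 0 by have [_] := s2valP (ex i); apply.
have near_eq (x : X) N : \forall z \near x, forall i, (i < N)%N -> phi i z = phi i x.
  elim: N => [|N IH]; first by apply: nearW.
  near=> z => i; rewrite ltnS leq_eqVlt => /orP[/eqP ->|iN].
    by near: z; exact: phic.
  by move: i iN; near: z.
have bd (x : X) : {n | nbhs x (C n)} by exact/cid/CX.
pose Phi x : {poly int} := \poly_(i < (sval (bd x)).+1) phi i x.
have PhiE x i : (Phi x)`_i = phi i x.
  rewrite coef_poly; case: ltnP => // ni.
  by rewrite (phi0 _ _ _ ni) //; exact: nbhs_singleton (svalP (bd x)).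
have Phic : locally_constant Phi.
  move=> x; near=> z; apply/polyP => i; rewrite !PhiE.
  have [iN|Ni] := ltnP i (sval (bd x)).+1.
    by move: i iN; near: z; exact: near_eq.
  rewrite (phi0 _ _ _ Ni) ?(phi0 _ _ _ Ni) //; last by near: z; exact: (svalP (bd x)).
  exact: nbhs_singleton (svalP (bd x)).
(* The coefficient of degree [size p] of a polynomial p is 0. *)
have := s2valP' (ex (size (evaluation y Phi))); apply.
rewrite -[RHS](nth_default 0 (leqnn (size (evaluation y Phi)))) -/(coefp _ _).
rewrite -evaluation_additive //; congr evaluation.
by apply/funext => x; rewrite /= PhiE.
Unshelve. all: by end_near. Qed.

End Compactness.

(** * Extending a homomorphism from a pure subgroup of functions *)

Section Extension.
Context (K : Type).
Implicit Types (T S : set (K -> int)) (psi : (K -> int) -> int).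

(** Homomorphisms on a subgroup T are represented by functions on all of K -> int,
    which behave additively on T only. *)
Definition additive_on T psi := forall u v, T u -> T v -> psi (u \- v) = psi u - psi v.

(** If b is not in T, then by purity no nonzero multiple of it is, so the sum of T
    and the multiples of b is direct and b may be given the value 0. *)
Lemma additive_extend1 T psi (b : K -> int) :
  T (fun=> 0) -> (forall u v, T u -> T v -> T (u \- v)) -> additive_on T psi ->
  (forall k : int, k != 0 -> T (fun x => b x * k) -> T b) ->
  exists psi', (forall u, T u -> psi' u = psi u) /\
    additive_on [set v | exists2 t, T t & exists k : int, v = (fun x => t x + b x * k)] psi'.
Proof.
move=> T0 TB psiB bT.
have [Tb|nTb] := pselect (T b).
  have TM u (k : int) : T u -> T (fun x => u x * k).
    have TN v : T v -> T (fun x => - v x).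
      move=> Tv; rewrite (_ : (fun x => - v x) = (fun=> 0) \- v); first exact: TB.
      by apply/funext => x /=; rewrite sub0r.
    move=> Tu; have Tn n : T (fun x => u x * n%:Z).
      elim: n => [|n IH].
        by rewrite (_ : (fun x => _) = fun=> 0) //; apply/funext => x; rewrite mulr0.
      rewrite (_ : (fun x => _) = (fun x => u x * n%:Z) \- (fun x => - u x)).
        by apply: TB => //; exact: TN.
      by apply/funext => x /=; rewrite -addn1 PoszD mulrDr mulr1 opprK.
    case: k => n; first exact: Tn.
    rewrite (_ : (fun x => _) = (fun x => - (u x * n.+1%:Z))); first exact: TN.
    by apply/funext => x; rewrite NegzE mulrN.
  have sub v : (exists2 t, T t & exists k : int, v = (fun x => t x + b x * k)) -> T v.
    move=> [t Tt [k ->]].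
    rewrite (_ : (fun x => _) = t \- (fun x => b x * - k)); first by apply: TB => //; exact: TM.
    by apply/funext => x /=; rewrite mulrN opprK.
  by exists psi; split=> // u v /sub Tu /sub Tv; exact: psiB.
pose dec (v : K -> int) (tk : (K -> int) * int) := T tk.1 /\ v = (fun x => tk.1 x + b x * tk.2).
have dec_uniq v tk tk' : dec v tk -> dec v tk' -> tk.1 = tk'.1.
  move: tk tk' => [t k] [t' k'] [/= Tt ->] [/= Tt' e].
  have ex x : t x + b x * k = t' x + b x * k' by exact: (congr1 (fun h => h x) e).
  have kk : k = k'.
    apply/eqP; rewrite -subr_eq0; apply/negP => /negP kk; apply: nTb; apply: bT kk _.
    rewrite (_ : (fun x => _) = t' \- t); first exact: TB.
    by apply/funext => x /=; rewrite mulrBr; have := ex x; lia.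
  by apply/funext => x; have := ex x; rewrite kk => /addIr.
pose psi' v := psi (xget (fun=> 0, 0) (dec v)).1.
have psi'E v tk : dec v tk -> psi' v = psi tk.1.
  move=> dv; congr psi; apply: (dec_uniq v _ _ _ dv).
  by apply: xgetPex; exists tk.
exists psi'; split.
  move=> u Tu; apply: (psi'E _ (u, 0)); split=> //=.
  by apply/funext => x; rewrite mulr0 addr0.
move=> _ _ [t Tt [k ->]] [t' Tt' [k' ->]].
rewrite (psi'E (fun x => t x + b x * k) (t, k)) //.
rewrite (psi'E (fun x => t' x + b x * k') (t', k')) //= -psiB //.
apply: (psi'E _ (t \- t', k - k')); split; first exact: TB.
by apply/funext => x /=; rewrite mulrBr; lia.
Qed.

Context (S : set (K -> int)).
Hypothesis S_op : forall (u : int -> int -> int) s t, S s -> S t -> S (fun x => u (s x) (t x)).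
Hypothesis S0 : S (fun=> 0).

Definition factoring (C : Type) (e : K -> C) : set (K -> int) :=
  [set f | exists2 s, S s & exists g : C -> int, f = (fun x => s x + g (e x))].

Lemma factoring0 (C : Type) (e : K -> C) : factoring e (fun=> 0).
Proof. by exists (fun=> 0) => //; exists (fun=> 0); apply/funext => x; rewrite addr0. Qed.

Lemma factoringB (C : Type) (e : K -> C) u v :
  factoring e u -> factoring e v -> factoring e (u \- v).
Proof.
move=> [s Ss [g ->]] [t St [h ->]]; exists (fun x => s x - t x).
  exact: (S_op (fun m n => m - n)).
by exists (fun c => g c - h c); apply/funext => x /=; lia.
Qed.

(** Suppose k f = s + g o e. Then s and - g o e have the same remainder modulo k,
    so this remainder factors through e, and integer division by k writes f as the
    quotient of s, which is in S, plus a function factoring through e. *)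
Lemma factoring_pure (C : Type) (e : K -> C) (f : K -> int) (k : int) :
  k != 0 -> factoring e (fun x => f x * k) -> factoring e f.
Proof.
move=> k0 [s Ss [g fE]].
exists (fun x => (s x %/ k)%Z); first exact: (S_op (fun m _ => (m %/ k)%Z) Ss Ss).
exists (fun c => ((g c + (- g c %% k)%Z) %/ k)%Z); apply/funext => x.
have fx : f x * k = s x + g (e x) by exact: (congr1 (fun h => h x) fE).
have -> : (- g (e x) %% k)%Z = (s x %% k)%Z.
  by rewrite -(modzMDl (f x) (- g (e x))) fx addrK.
have -> : g (e x) + (s x %% k)%Z = (f x - (s x %/ k)%Z) * k.
  by rewrite mulrBl fx {2}(divz_eq (s x) k); lia.
by rewrite mulzK // addrC subrK.
Qed.

Lemma factoring_sub (C C' : Type) (e : K -> C) (e' : K -> C') (p : C' -> C) :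
  (forall x, e x = p (e' x)) -> factoring e `<=` factoring e'.
Proof.
move=> ep _ [s Ss [g ->]]; exists s => //; exists (g \o p).
by apply/funext => x /=; rewrite ep.
Qed.

(** Refine the code e by the additional bit a for one value w of e at a time. Each
    step enlarges the subgroup by the multiples of a single function b, the
    indicator of the points with code w and bit true. *)
Lemma additive_extend_split (C : finType) (e : K -> C) (a : K -> bool) psi :
  additive_on (factoring e) psi ->
  exists psi', (forall u, factoring e u -> psi' u = psi u) /\
    additive_on (factoring (fun x => (e x, a x))) psi'.
Proof.
move=> psiB; pose eW (W : seq C) x := (e x, (e x \in W) && a x).
have [psi' [psi'E psi'B]] : exists psi', (forall u, factoring e u -> psi' u = psi u) /\
    additive_on (factoring (eW (enum C))) psi'.
  elim: (enum C) => [|w W [psi' [psi'E psi'B]]].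
    exists psi; split=> // u v Tu Tv.
    by apply: psiB; apply: (@factoring_sub _ _ _ _ (fun c => (c, false))) => [x|];
      [|exact: Tu|exact|exact: Tv].
  (* If w occurs in W, its points are split already and b is 0. *)
  pose b x : int := ([&& e x == w, w \notin W & a x])%:R.
  have [||k k0|psi'' [psi''E psi''B]] := additive_extend1 (b := b) _ _ psi'B.
  - exact: factoring0.
  - exact: factoringB.
  - exact: factoring_pure.
  exists psi''; split=> [u Tu|].
    rewrite psi''E ?psi'E //.
    exact: (@factoring_sub _ _ _ _ fst).
  have sub u : factoring (eW (w :: W)) u ->
      exists2 t, factoring (eW W) t & exists k : int, u = (fun x => t x + b x * k).
    move=> [s Ss [g ->]]; exists (fun x => s x + g (eW W x)); first by exists s => //; exists g.
    exists (g (w, true) - g (w, false)); apply/funext => x; rewrite -addrA; congr (_ + _).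
    rewrite /eW /b in_cons; case: eqVneq => [->|_] /=; last by rewrite mul0r addr0.
    by case: (w \in W); case: (a x); rewrite /= ?mul0r ?addr0 ?mul1r ?subrKC // addrC subrK.
  by move=> u v /sub Tu /sub Tv; exact: psi''B.
exists psi'; split=> // u v Tu Tv; apply: psi'B.
  apply: (@factoring_sub _ _ _ _ id) Tu => x; by rewrite /eW mem_enum.
by apply: (@factoring_sub _ _ _ _ id) Tv => x; rewrite /eW mem_enum.
Qed.

Context (a : nat -> K -> bool).

(** Codes are nested pairs, so that the refinement of [encode n] by the predicate
    [a n] in [additive_extend_split] is literally [encode n.+1]. *)
Fixpoint code n : finType := if n is m.+1 then (code m * bool)%type else unit.

Fixpoint encode n : K -> code n :=
  if n is m.+1 then fun x => (encode m x, a m x) else fun=> tt.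

Lemma encode_eq n x y : encode n x = encode n y -> forall m, (m < n)%N -> a m x = a m y.
Proof.
elim: n => //= n IH [/IH e axy] m; rewrite ltnS leq_eqVlt => /orP[/eqP -> //|]; exact: e.
Qed.

Lemma factoring_encodeS n : factoring (encode n) `<=` factoring (encode n.+1).
Proof. exact: (@factoring_sub _ _ _ _ fst). Qed.

Lemma factoring_encode_le n m : (n <= m)%N -> factoring (encode n) `<=` factoring (encode m).
Proof.
by move=> /subnK <-; elim: (m - n)%N => // k IH u /IH; exact: factoring_encodeS.
Qed.

(** The subgroups belonging to the codes [encode n] increase with n, and the
    homomorphism is extended from each to the next. *)
Lemma additive_extension psi : additive_on S psi ->
  exists nu, (forall s, S s -> nu s = psi s) /\
    additive_on [set f | exists n, factoring (encode n) f] nu.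
Proof.
move=> psiB.
have sub0 : factoring (encode 0) `<=` S.
  by move=> _ [s Ss [g ->]] /=; exact: (S_op (fun m _ => m + g tt) Ss Ss).
have psi0B : additive_on (factoring (encode 0)) psi.
  by move=> u v /sub0 Su /sub0 Sv; exact: psiB.
pose F n := {p | additive_on (factoring (encode n)) p}.
have step n (p : F n) : {q : F n.+1 | forall u, factoring (encode n) u -> sval q u = sval p u}.
  have [q [qE qB]] := cid (additive_extend_split (a n) (svalP p)).
  by exists (exist _ q qB).
pose p := nat_rect F (exist _ psi psi0B) (fun n q => sval (step n q)).
have pS n u : factoring (encode n) u -> sval (p n.+1) u = sval (p n) u.
  exact: (svalP (step n (p n))).
have pE n m u : (n <= m)%N -> factoring (encode n) u -> sval (p m) u = sval (p n) u.
  move=> /subnK <- nu; elim: (m - n)%N => // k IH; rewrite addSn pS //.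
  by apply: factoring_encode_le nu; exact: leq_addl.
pose nu u := if pselect (exists n, factoring (encode n) u) is left e
  then sval (p (projT1 (cid e))) u else 0.
have nuE n u : factoring (encode n) u -> nu u = sval (p n) u.
  move=> un; rewrite /nu; case: pselect => [e|[]]; last by exists n.
  case: (cid e) => m /= um.
  by rewrite -(pE _ _ _ (leq_maxl m n) um) (pE _ _ _ (leq_maxr m n) un).
exists nu; split.
  move=> s Ss; apply: (nuE 0%N); exists s => //; exists (fun=> 0).
  by apply/funext => x; rewrite addr0.
move=> u v [n un] [m vm].
have um := factoring_encode_le (leq_maxl n m) un.
have vn := factoring_encode_le (leq_maxr n m) vm.
rewrite !(nuE (maxn n m)) //; first exact: (svalP (p (maxn n m))).
exact: factoringB.
Qed.

Lemma factoring_encodeP n (f : K -> int) :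
  (forall x y, encode n x = encode n y -> f x = f y) -> factoring (encode n) f.
Proof.
move=> fe; exists (fun=> 0) => //.
exists (fun c => if pselect (exists x, encode n x = c) is left e then f (projT1 (cid e)) else 0).
apply/funext => x; rewrite add0r; case: pselect => [e|[]]; last by exists x.
by apply: fe; case: (cid e).
Qed.

End Extension.

(** * Surjectivity in degree 0 *)

Section QuasiHomologyZero.
Context (R : realType).

Lemma pairing_term (X : topologicalType) (E : ANR_expansion R X) (x : qH 0 E) l
    (phi : ex_sp l -> int) (phic : locally_constant phi) :
  pairing phic (@lim_proj (qH_diagram 0 E) l x) = evaluation x (phi \o ex_proj E l).
Proof. by rewrite evaluationE. Qed.

Lemma qH_ext (X : topologicalType) (E : ANR_expansion R X) (x x' : qH 0 E) :
  (forall phi : X -> int, locally_constant phi -> evaluation x phi = evaluation x' phi) -> x = x'.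
Proof.
move=> xx'; apply: limit_ext => l; apply: (singH0_separation (ex_ANR l)) => phi phic.
rewrite !pairing_term; apply: xx'; apply: locally_constant_comp phic; exact: cts_fun.
Qed.

Context (X Y : topologicalType) (EX : ANR_expansion R X) (EY : ANR_expansion R Y).
Context (f : continuousType X Y).

(** The left side computes the image of x under the map induced by f on the term m,
    whose values are thus independent of the factorization g. *)
Lemma pairing_factor l m (g : continuousType (ex_sp l) (ex_sp m)) (x : qH 0 EX)
    (phi : ex_sp m -> int) (phic : locally_constant phi) :
  homotopic R (ex_proj EY m \o f) (g \o ex_proj EX l) ->
  pairing phic (singH_map R g 0 (@lim_proj (qH_diagram 0 EX) l x)) =
    evaluation x (phi \o ex_proj EY m \o f).
Proof.
move=> fg; have gc := locally_constant_comp (cts_fun (s := g)) phic.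
rewrite (pairing_map phic gc) pairing_term; congr evaluation; apply/funext => z.
exact: esym (homotopic_locally_constant fg phic z).
Qed.

Lemma factor_ex m : exists l (g : continuousType (ex_sp l) (ex_sp m)),
  homotopic R (ex_proj EY m \o f) (g \o ex_proj EX l).
Proof. exact: (ex_E1 EX (ex_proj EY m \o f) (ex_ANR m)). Qed.

(** Take any factorization on each term. Both compatibility with the bonding maps and
    independence of the factorization are checked on values ([pairing_factor],
    [singH0_separation]). *)
Lemma qH_map_ex : exists h : {additive qH 0 EX -> qH 0 EY},
  forall (l : ex_idx EX) (m : ex_idx EY) (g : continuousType (ex_sp l) (ex_sp m)),
      homotopic R (ex_proj EY m \o f) (g \o ex_proj EX l) ->
      forall x : qH 0 EX, @lim_proj (qH_diagram 0 EY) m (h x) =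
        singH_map R g 0 (@lim_proj (qH_diagram 0 EX) l x).
Proof.
have ch m : {l : ex_idx EX & {g : continuousType (ex_sp l) (ex_sp m) |
    homotopic R (ex_proj EY m \o f) (g \o ex_proj EX l)}}.
  by have [l lP] := cid (factor_ex m); exists l; exact: cid.
pose c (x : qH 0 EX) : zprod (@dgrp (qH_diagram 0 EY)) := fun m =>
  singH_map R (sval (projT2 (ch m))) 0 (@lim_proj (qH_diagram 0 EX) (projT1 (ch m)) x).
have cE m (x : qH 0 EX) (phi : ex_sp m -> int) (phic : locally_constant phi) :
    pairing phic (c x m : singH R (ex_sp m) 0) = evaluation x (phi \o ex_proj EY m \o f).
  exact: (pairing_factor x phic (svalP (projT2 (ch m)))).
have cl x : c x \in lim_pred (D := qH_diagram 0 EY).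
  apply/asboolP => m m' mm'; apply: (singH0_separation (ex_ANR m')) => phi phic.
  have bc := locally_constant_comp (cts_fun (s := ex_bond mm')) phic.
  apply: etrans (pairing_map phic bc _) _.
  rewrite !cE; congr evaluation; apply/funext => z.
  exact: (homotopic_locally_constant (ex_proj_bond mm') phic (f z)).
pose h x : qH 0 EY := exist (fun b => b \in lim_pred (D := qH_diagram 0 EY)) _ (cl x).
have h_add : zmod_morphism h.
  move=> x y; apply: val_inj; apply: functional_extensionality_dep => m.
  by rewrite /= /c !raddfB.
pose h' : {additive qH 0 EX -> qH 0 EY} :=
  HB.pack h (GRing.isZmodMorphism.Build _ _ h h_add).
exists h' => l m g fg x; apply: (singH0_separation (ex_ANR m)) => phi phic.
by rewrite (pairing_factor _ _ fg) -(cE m x phi phic).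
Qed.

(** The map induced by f, which is given only by its characteristic property, acts
    on values by composition with f. *)
Lemma evaluation_qH_map (x : qH 0 EX) (phi : Y -> int) : locally_constant phi ->
  evaluation (qH_map 0 EX EY f x) phi = evaluation x (phi \o f).
Proof.
move=> /(evaluation_factor EY)[m [psi [psic /funext ->]]].
rewrite -(pairing_term _ psic).
have [h hP] := qH_map_ex.
rewrite /qH_map (@the_homP _ _ _ h) // => [|h' h'P z]; last first.
  apply: limit_ext => k; have [l [g fg]] := factor_ex k.
  by rewrite (hP _ _ _ fg) (h'P _ _ _ fg).
have [l [g fg]] := factor_ex m.
by rewrite (hP _ _ _ fg) (pairing_factor _ _ fg).
Qed.

End QuasiHomologyZero.

Section PseudoHomologyZero.
Context (R : realType) (X : topologicalType) (E : ANR_expansion R X).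
Context (EK : forall K : compacts X, ANR_expansion R K).

Lemma tau_homologyE (K : compacts X) (x : qH 0 (EK K)) :
  tau_homology 0 E EK (@colim_in (pH_diagram 0 EK) K x) = qH_map 0 (EK K) E (Defs.incl K) x.
Proof.
have [|h hE] := @colim_desc (pH_diagram 0 EK) _ (fun K => qH_map 0 (EK K) E (Defs.incl K)).
  move=> L M LM z; apply: qH_ext => phi phic.
  have Lc := locally_constant_comp (cts_fun (s := Defs.incl M)) phic.
  rewrite (evaluation_qH_map _ _ _ phic).
  apply: etrans (evaluation_qH_map _ _ _ Lc) _.
  by rewrite (evaluation_qH_map _ _ _ phic).
rewrite /tau_homology (@the_homP _ _ _ h) ?hE // => h' h'P.
by apply: (@colim_ext (pH_diagram 0 EK)) => L z; rewrite h'P hE.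
Qed.

Section Realization.
Context (K : topologicalType) (nu : (K -> int) -> int).
Hypothesis Kc : compact [set: K].
Hypothesis nuB : additive_on (@locally_constant K int) nu.

Let nu0 : nu (fun=> 0) = 0.
Proof.
apply: etrans (etrans (nuB (locally_constant_cst 0) (locally_constant_cst 0)) (subrr _)).
by congr nu; apply/funext => x; rewrite /= subrr.
Qed.

Let nuN u : locally_constant u -> nu (fun x => - u x) = - nu u.
Proof.
move=> uc; rewrite -[RHS]sub0r -nu0 -nuB //; last exact: locally_constant_cst.
by congr nu; apply/funext => x; rewrite /= sub0r.
Qed.

Let nuD u v : locally_constant u -> locally_constant v ->
  nu (fun x => u x + v x) = nu u + nu v.
Proof.
move=> uc vc; rewrite -[nu v]opprK -nuN // -nuB //.
  by congr nu; apply/funext => x; rewrite /= opprK.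
exact: (locally_constant_map -%R vc).
Qed.

Let nuM u (k : int) : locally_constant u -> nu (fun x => k * u x) = k * nu u.
Proof.
move=> uc; have nuMn n : nu (fun x => n%:Z * u x) = n%:Z * nu u.
  elim: n => [|n IH].
    by rewrite mul0r -[RHS]nu0; congr nu; apply/funext => x; rewrite mul0r.
  rewrite (_ : (fun x => _) = fun x => n%:Z * u x + u x).
    rewrite nuD // ?IH; first by rewrite -addn1 PoszD mulrDl mul1r.
    exact: (locally_constant_map ( *%R n%:Z) uc).
  by apply/funext => x; rewrite -addn1 PoszD mulrDl mul1r.
case: k => n; first exact: nuMn.
rewrite NegzE (_ : (fun x => _) = fun x => - (n.+1%:Z * u x)).
  by rewrite nuN ?nuMn ?mulNr //; exact: (locally_constant_map ( *%R n.+1%:Z) uc).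
by apply/funext => x; rewrite mulNr.
Qed.

Let nu_sum (I : Type) (s : seq I) (c : I -> int) (u : I -> K -> int) :
  (forall i, locally_constant (u i)) ->
  nu (fun x => \sum_(i <- s) c i * u i x) = \sum_(i <- s) c i * nu (u i).
Proof.
move=> uc; elim: s => [|i s IH].
  by rewrite big_nil -[RHS]nu0; congr nu; apply/funext => x; rewrite big_nil.
rewrite big_cons -IH -nuM // -nuD.
- by congr nu; apply/funext => x; rewrite big_cons.
- exact: (locally_constant_map ( *%R (c i)) (uc i)).
- elim: s {IH} => [|j s IH].
    rewrite (_ : (fun x => _) = fun=> 0); first exact: locally_constant_cst.
    by apply/funext => x; rewrite big_nil.
  rewrite (_ : (fun x => _) = fun x => c j * u j x + \sum_(k <- s) c k * u k x).
    by apply: locally_constant_map2 => //; exact: (locally_constant_map ( *%R (c j)) (uc j)).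
  by apply/funext => x; rewrite big_cons.
Qed.

(** The map c from K to the discrete set H_0(Q) has finitely many values g, each the
    class of a point. The class sought is the sum of the g with multiplicity the
    value of nu at the indicator of the fibre of c over g. *)
Lemma singH0_realization (Q : topologicalType) (p : continuousType K Q) : ANR R Q ->
  exists h : singH R Q 0, forall (phi : Q -> int) (phic : locally_constant phi),
    pairing phic h = nu (phi \o p).
Proof.
move=> QA; pose c x := point_class R (p x).
have cc : locally_constant c.
  exact: (locally_constant_comp (cts_fun (s := p)) (point_class_locally_constant QA)).
have [g _|x|s [_ sc]] := @compact_finite_cover K _ setT (fun g => [set x | c x = g]) Kc.
- by rewrite openE => x /= <-; exact: cc.
- by exists (c x).
have {}sc x : c x \in undup s by have [g gs /= ->] := sc x; rewrite mem_undup.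
pose ind g x : int := (c x == g)%:R.
have indc g : locally_constant (ind g) by exact: (locally_constant_map (fun h => (h == g)%:R) cc).
exists (\sum_(g <- undup s) g *~ nu (ind g)) => phi phic.
rewrite raddf_sum; under eq_bigr do rewrite raddfMz -mulrzl mulrC.
under eq_bigr do rewrite intz; rewrite -nu_sum //; congr nu; apply/funext => x.
rewrite (bigD1_seq (c x)) ?undup_uniq //= big1 => [|g gx].
  by rewrite addr0 /ind eqxx mulr1 pairingE.
by rewrite /ind eq_sym (negPf gx) mulr0.
Qed.

Lemma qH_realization (F : ANR_expansion R K) :
  exists x : qH 0 F, forall phi : K -> int, locally_constant phi -> evaluation x phi = nu phi.
Proof.
have ch l := cid (singH0_realization (ex_proj F l) (ex_ANR l)).
pose x : zprod (@dgrp (qH_diagram 0 F)) := fun l => sval (ch l).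
have xE l (phi : ex_sp l -> int) (phic : locally_constant phi) :
  pairing phic (x l : singH R (ex_sp l) 0) = nu (phi \o ex_proj F l) by exact: (svalP (ch l)).
have xl : x \in lim_pred (D := qH_diagram 0 F).
  apply/asboolP => m l lm; apply: (singH0_separation (ex_ANR l)) => phi phic.
  have bc := locally_constant_comp (cts_fun (s := ex_bond lm)) phic.
  apply: etrans (pairing_map phic bc _) _.
  rewrite !xE; congr nu; apply/funext => z.
  exact: (homotopic_locally_constant (ex_proj_bond lm) phic z).
exists (exist (fun b => b \in lim_pred (D := qH_diagram 0 F)) _ xl) => phi.
move=> /(evaluation_factor F)[l [psi [psic /funext ->]]].
by rewrite -(pairing_term _ psic); exact: xE.
Qed.

End Realization.

(** Since K supports y, the values of y define a homomorphism on the restrictions to K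
    of the locally constant functions on X, which are closed under pointwise
    operations. Code the points of K by
    their membership in the sets of a countable base of X: by compactness every
    locally constant function on K factors through a finite part of the code, so
    [additive_extension] reaches it. *)
Lemma evaluation_extension (K : compacts X) (y : qH 0 E) :
  metrizable R X -> separable X ->
  (forall phi : X -> int, locally_constant phi ->
    (forall x, cpt_set K x -> phi x = 0) -> evaluation y phi = 0) ->
  exists nu : (K -> int) -> int, additive_on (@locally_constant K int) nu /\
    forall phi : X -> int, locally_constant phi -> nu (phi \o set_val) = evaluation y phi.
Proof.
move=> Xm Xs ysupp.
have [B [Bo Bb]] := separable_countable_base Xm Xs.
pose S := [set s : K -> int | exists2 phi : X -> int, locally_constant phi & s = phi \o set_val].
have evB (phi psi : X -> int) : locally_constant phi -> locally_constant psi ->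
    evaluation y (phi \- psi) = evaluation y phi - evaluation y psi.
  move=> phic psic; apply/eqP; rewrite eq_sym subr_eq -evaluationD //.
    by apply/eqP; congr evaluation; apply/funext => x; rewrite /= subrK.
  exact: (locally_constant_map2 (fun m n => m - n) phic psic).
pose psi s := if pselect (S s) is left e then evaluation y (s2val (cid2 e)) else 0.
have psiE phi : locally_constant phi -> psi (phi \o set_val) = evaluation y phi.
  move=> phic; rewrite /psi; case: pselect => [e|[]]; last by exists phi.
  case: (cid2 e) => phi' /= phi'c e'; apply/eqP; rewrite -subr_eq0 -evB //; apply/eqP.
  apply: ysupp; first exact: (locally_constant_map2 (fun m n => m - n) phi'c phic).
  move=> x Kx; have := congr1 (fun h => h (exist _ x (mem_set Kx))) e'.
  by rewrite /= => ->; rewrite subrr.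
have S_op (u : int -> int -> int) s t : S s -> S t -> S (fun x => u (s x) (t x)).
  move=> [phi phic ->] [phi' phi'c ->]; exists (fun x => u (phi x) (phi' x)) => //.
  exact: locally_constant_map2.
have S0 : S (fun=> 0) by exists (fun=> 0) => //; exact: locally_constant_cst.
have psiB : additive_on S psi.
  move=> _ _ [phi phic ->] [phi' phi'c ->]; rewrite !psiE // -evB // -psiE //.
  exact: (locally_constant_map2 (fun m n => m - n) phic phi'c).
have [nu [nuE nuB]] := additive_extension S_op S0 (fun n (x : K) => `[< B n (set_val x) >]) psiB.
exists nu; split; last by move=> phi phic; rewrite nuE ?psiE //; exists phi.
suff lcf f : locally_constant f -> exists n,
    factoring S (encode (fun n (x : K) => `[< B n (set_val x) >]) n) f.
  by move=> u v /lcf Tu /lcf Tv; exact: nuB.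
move=> fc.
have [n _|x|s [sD sU]] := @compact_finite_cover K _
    [set n | forall x y : K, B n (set_val x) -> B n (set_val y) -> f x = f y]
    (fun n => set_val @^-1` B n) (compact_setT_sub (@cpt_compact _ K)).
- by apply: open_comp => // x _; exact: set_val_continuous.
- have [_ [[C oC <-] /= Cx CB]] := fc x.
  have [n [Bx BC]] := Bb (set_val x) C (open_nbhs_nbhs (conj oC Cx)).
  by exists n => // z z' /BC zC /BC z'C; rewrite (CB z zC) (CB z' z'C).
exists (\max_(n <- s) n).+1; apply: factoring_encodeP => // x x' e; have xx' := encode_eq e.
have [n ns Bx] := sU x.
apply: (sD n ns) => //; apply/asboolP.
by rewrite -xx' ?ltnS ?leq_bigmax_seq //; apply/asboolP.
Qed.

Lemma tau_homology_surj : local_compactum R X ->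
  forall y : qH 0 E, exists x : pH 0 EK, tau_homology 0 E EK x = y.
Proof.
move=> Xlc y; have [_ Xs Xm] := Xlc.
have [K ysupp] := evaluation_compact_support y Xlc.
have [nu [nuB nuE]] := evaluation_extension Xm Xs ysupp.
have [x xE] := qH_realization (compact_setT_sub (@cpt_compact _ K)) nuB (EK K).
exists (@colim_in (pH_diagram 0 EK) K x); rewrite tau_homologyE.
apply: qH_ext => phi phic; rewrite evaluation_qH_map // xE ?nuE //.
by apply: locally_constant_comp phic; exact: set_val_continuous.
Qed.

End PseudoHomologyZero.

Theorem theorem2 (R : realType) :
  (forall (X : topologicalType) (E : ANR_expansion R X)
          (EK : forall K : compacts X, ANR_expansion R (set_type (cpt_set K))),
     local_compactum R X ->
     forall y : qH 0 E, exists x : pH 0 EK, tau_homology 0 E EK x = y) /\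
  (forall (X : topologicalType) (E : ANR_expansion R X),
     metrizable R X -> bijective (tau_cohomology 0 E)).
Proof.
split=> [X E EK Xlc|X E Xm]; first exact: tau_homology_surj.
apply: inj_surj_bijective; first exact: tau_cohomology_inj.
exact: tau_cohomology_surj.
Qed.
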